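(* Let $X$ be a real reflexive Banach space, let $K$ be a nonempty, closed and convex subset of $X$ (not assumed bounded), and let $A:K\to 2^{X^*}$ be a set valued mapping with $A(u)\neq\emptyset$ for all $u\in K$ which is monotone and lower hemicontinuous on $K$. Let $\phi:X\to(-\infty,+\infty]$ be convex and lower semicontinuous with $0\in K\cap D(\phi)$, let $T:X\to L^p(\Omega;\mathbb{R}^k)$ be linear and compact (write $\hat u=Tu$), and let $j:\Omega\times\mathbb{R}^k\to\mathbb{R}$ be a Carathéodory function, locally Lipschitz with respect to the second variable, for which there exists $C>0$ such that $|z|\leq C(1+|y|^{p-1})$ for a.e. $x\in\Omega$, all $y\in\mathbb{R}^k$ and all $z\in\partial j(x,y)$. For $n=1,2,\ldots$ let $K_n=\{u\in K:\|u\|\leq n\}$, and let $u_n\in K_n$ and $u_n^*\in A(u_n)$ be two sequences such that for every $n\geq 1$ $$\langle u_n^*,v-u_n\rangle+\phi(v)-\phi(u_n)+\int_\Omega j^0(x,\hat u_n(x);\hat v(x)-\hat u_n(x))\,dx\geq 0\quad\text{for all } v\in K_n.$$ Then each of the following conditions (H1), (H2), (H3) is sufficient for the existence of $u\in K$ and $u^*\in A(u)$ such that $$\langle u^*,v-u\rangle+\phi(v)-\phi(u)+\int_\Omega j^0(x,\hat u(x);\hat v(x)-\hat u(x))\,dx\geq 0\quad\text{for all } v\in K:$$ (H1) There exists a positive integer $n_0$ such that $\|u_{n_0}\|<n_0$. (H2) There exists a positive integer $n_0$ such that $$\langle u_{n_0}^*,-u_{n_0}\rangle+\phi(0)-\phi(u_{n_0})+\int_\Omega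 j^0(x,\hat u_{n_0}(x);-\hat u_{n_0}(x))\,dx\leq 0.$$ (H3) There exist $u_0\in K\cap D(\phi)$ and $q\geq p$ such that for any sequence $\{w_n\}\subset K$ with $\|w_n\|\to\infty$ as $n\to\infty$, $$\frac{\langle w_n^*,w_n-u_0\rangle}{\|w_n\|^q}\to\infty\quad\text{as } n\to\infty$$ for every choice of $w_n^*\in A(w_n)$.
   Context: Setting: $X$ is a real reflexive Banach space with norm $\|\cdot\|$, dual $X^*$ and duality pairing $\langle\cdot,\cdot\rangle$; $1<p<\infty$; $\Omega$ is a bounded open subset of $\mathbb{R}^N$; $k\geq 1$; $|\cdot|$ is the Euclidean norm and ''$\cdot$'' the inner product on $\mathbb{R}^k$. $$j^0(x,y;h)=\limsup_{w\to y,\ \lambda\downarrow 0}\frac{j(x,w+\lambda h)-j(x,w)}{\lambda}$$ is Clarke's generalized directional derivative of $j(x,\cdot)$ at $y$ in the direction $h$, and $\partial j(x,y)=\{z\in\mathbb{R}^k: z\cdot h\leq j^0(x,y;h)\text{ for all }h\in\mathbb{R}^k\}$ is Clarke's generalized gradient of $j(x,\cdot)$ at $y$. $D(\phi)=\{u\in X:\phi(u)<+\infty\}$. The inequalities over $K$ and $K_n$ are understood to hold trivially for those $v$ with $v\notin D(\phi)$ when the candidate solution lies in $D(\phi)$; no element outside $D(\phi)$ satisfies them (test with $v=0$). A set valued mapping $A:K\to 2^{X^*}$ is monotone on $K$ if $\langle v^*-u^*,v-u\rangle\geq 0$ for all $u,v\in K$, $u^*\in A(u)$, $v^*\in A(v)$.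 It is lower hemicontinuous on $K$ if its restriction to every line segment of $K$ is lower semicontinuous with respect to the weak-star topology of $X^*$, i.e. for every line segment $L\subset K$, every $u\in L$, every $u^*\in A(u)$ and every sequence $(u_n)\subset L$ with $u_n\to u$, there exist $u_n^*\in A(u_n)$ such that $u_n^*$ converges weakly-star to $u^*$. *)

(* Defs.v *)
From HB Require Import structures.
From mathcomp Require Import all_boot all_order all_algebra.
From mathcomp Require Import all_classical all_reals all_analysis.
Set Implicit Arguments.
Unset Strict Implicit.
Unset Printing Implicit Defensive.
Import Order.TTheory GRing.Theory Num.Theory.
Import numFieldNormedType.Exports.
Local Open Scope classical_set_scope.
Local Open Scope ring_scope.

Section dual.
Context (R : realType) (X : normedModType R).

Definition cont_linear : {pred X -> R^o} :=
  fun f => `[< linear f /\ continuous f >].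

Lemma cont_linearP (f : X -> R^o) :
  reflect (linear f /\ continuous f) (f \in cont_linear).
Proof. exact: asboolP. Qed.

Lemma cont_linear_submod_closed : submod_closed cont_linear.
Proof.
split.
  apply/cont_linearP; split; first by move=> a u v; rewrite /= scaler0 addr0.
  by move=> x; apply: cvg_cst.
move=> a f g /cont_linearP[lf cf] /cont_linearP[lg cg]; apply/cont_linearP; split.
  move=> b u v; rewrite !fctE lf lg !scalerDr !scalerA (mulrC a b) !addrA.
  by congr (_ + _); rewrite addrAC.
by move=> x; apply: cvgD; [apply: cvgZl_tmp; exact: cf|exact: cg].
Qed.

HB.instance Definition _ :=
  GRing.isSubmodClosed.Build R (X -> R^o) cont_linear cont_linear_submod_closed.

Record dual := Dual {
  dual_fun :> X -> R^o ;
  dualP : dual_fun \in cont_linear }.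

HB.instance Definition _ := [isSub for dual_fun].
HB.instance Definition _ := [Choice of dual by <:].
HB.instance Definition _ := [SubChoice_isSubLmodule of dual by <:].

Definition dual_norm (f : dual) : R := sup [set `|f x| | x in [set x | `|x| <= 1]].

Lemma dual_linear (f : dual) : linear f.
Proof. by have /cont_linearP[] := dualP f. Qed.

Lemma dualZ (f : dual) a x : f (a *: x) = a *: f x.
Proof.
have lf := dual_linear f.
have f0 : f 0 = 0.
  by have := lf (-1) 0 0; rewrite !scaleN1r oppr0 addr0 addNr.
by have := lf a x 0; rewrite !addr0 f0 addr0.
Qed.

Lemma dual_norm_has_sup (f : dual) :
  has_sup [set `|f x| | x in [set x | `|x| <= 1]].
Proof.
split; first by exists `|f 0|, 0 => //=; rewrite normr0.
have /cont_linearP[lf cf] := dualP f.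
pose F : {linear X -> R^o} := HB.pack (f : X -> R^o)
  (GRing.isLinear.Build _ _ _ _ (f : X -> R^o) lf).
have /linear_bounded_continuous/bounded_funP/(_ 1)[M fM] :
  continuous (F : X -> R^o) := cf.
by exists M => _ [x /= x1 <-]; exact: fM.
Qed.

Lemma dual_norm_ub (f : dual) x : `|x| <= 1 -> `|f x| <= dual_norm f.
Proof.
by move=> x1; apply: ub_le_sup; [case: (dual_norm_has_sup f)|exists x].
Qed.

Lemma dual_norm_le (f : dual) r :
  (forall x, `|x| <= 1 -> `|f x| <= r) -> dual_norm f <= r.
Proof.
move=> fr; apply: ge_sup; first by case: (dual_norm_has_sup f).
by move=> _ [x /= x1 <-]; exact: fr.
Qed.

Lemma ler_dual_normD (f g : dual) :
  dual_norm (f + g) <= dual_norm f + dual_norm g.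
Proof.
apply: dual_norm_le => x x1.
by apply: (le_trans (ler_normD _ _)); rewrite lerD// dual_norm_ub.
Qed.

Lemma dual_normZ_le a (f : dual) : dual_norm (a *: f) <= `|a| * dual_norm f.
Proof.
by apply: dual_norm_le => x x1; rewrite normrZ ler_wpM2l// dual_norm_ub.
Qed.

Lemma dual_normZ a (f : dual) : dual_norm (a *: f) = `|a| * dual_norm f.
Proof.
apply/eqP; rewrite eq_le dual_normZ_le/=.
have [->|a0] := eqVneq a 0.
  by rewrite normr0 mul0r (le_trans _ (@dual_norm_ub _ 0 _))// normr0.
rewrite -ler_pdivlMl ?normr_gt0// -normfV.
by rewrite (le_trans _ (dual_normZ_le _ _))// scalerA mulVf// scale1r.
Qed.

Lemma dual_norm_eq0 (f : dual) : dual_norm f = 0 -> f = 0.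
Proof.
move=> f0; apply/val_inj/funext => x /=.
have [->|x0] := eqVneq x 0.
  by have := dualZ f 0 0; rewrite !scale0r.
have : `|f (`|x|^-1 *: x)| <= 0.
  by rewrite -f0 dual_norm_ub// normrZ normfV normr_id mulVf// normr_eq0.
rewrite normr_le0 dualZ scaler_eq0 invr_eq0 normr_eq0 (negbTE x0)/=.
by move/eqP.
Qed.

HB.instance Definition _ :=
  Lmodule_isNormed.Build R dual ler_dual_normD dual_normZ dual_norm_eq0.

End dual.
Arguments dual {R} X.

Definition reflexive_space (R : realType) (X : normedModType R) :=
  forall F : dual (dual X), exists x : X, forall f : dual X, F f = f x.

Section lebesgue_measure_Rn.
Context (R : realType) (N : nat).
Local Open Scope ereal_scope.

(* [Some (a, b)] codes the half-open box with corners [a] and [b]; [None] codes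
   the empty set, which is not a box when [N = 0]. *)
Definition box (c : option ('rV[R]_N * 'rV[R]_N)) : set 'rV[R]_N :=
  if c is Some (a, b) then [set x | forall i, (a 0%R i < x 0%R i <= b 0%R i)%R]
  else set0.

Definition box_volume (c : option ('rV[R]_N * 'rV[R]_N)) : \bar R :=
  if c is Some (a, b) then (\prod_i Num.max 0 (b 0 i - a 0 i))%R%:E else 0.

Definition lebesgue_outer (A : set 'rV[R]_N) : \bar R :=
  ereal_inf [set \sum_(n <oo) box_volume (c n) |
    c in [set c | A `<=` \bigcup_n box (c n)]].

Lemma box_volume_ge0 c : 0 <= box_volume c.
Proof.
case: c => [[a b]|//]; rewrite lee_fin; apply: prodr_ge0 => i _.
by rewrite le_max lexx.
Qed.
Hint Resolve box_volume_ge0 : core.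

Lemma lebesgue_outer_ge0 A : 0 <= lebesgue_outer A.
Proof. by apply: le_ereal_inf_tmp => _ [c _ <-]; exact: nneseries_ge0. Qed.

Lemma lebesgue_outer0 : lebesgue_outer set0 = 0.
Proof.
apply/eqP; rewrite eq_le lebesgue_outer_ge0 andbT.
apply: ereal_inf_lbound; exists (fun=> None) => //.
by rewrite eseries0.
Qed.

Lemma le_lebesgue_outer : {homo lebesgue_outer : A B / A `<=` B >-> A <= B}.
Proof.
move=> A B AB; apply: ereal_inf_le_tmp => _ [c Bc <-].
by exists c => //; exact: subset_trans Bc.
Qed.

Lemma lebesgue_outer_sigma_subadditive : sigma_subadditive lebesgue_outer.
Proof.
move=> A; have [[i ioo]|] := pselect (exists i, lebesgue_outer (A i) = +oo).
  rewrite (eseries_pinfty _ _ ioo) ?leey// => n _.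
  by rewrite -ltNye (lt_le_trans _ (lebesgue_outer_ge0 _)).
rewrite -forallNE => Aoo.
apply/lee_addgt0Pr => e e0.
rewrite (le_trans _ (epsilon_trick _ _ (ltW e0)))//; last first.
  by move=> n; exact: lebesgue_outer_ge0.
have /choice[c Pc] : forall n, exists c : nat -> option ('rV[R]_N * 'rV[R]_N),
    A n `<=` \bigcup_k box (c k) /\
    \sum_(k <oo) box_volume (c k) <=
      lebesgue_outer (A n) + (e / (2 ^ n.+1)%:R)%:E.
  move=> n; have en : (0 < e / (2 ^ n.+1)%:R)%R.
    by rewrite divr_gt0// ltr0n expn_gt0.
  have Afin : lebesgue_outer (A n) \is a fin_num.
    by rewrite ge0_fin_numE ?lebesgue_outer_ge0// ltey; apply/eqP.
  have [_ [c Ac <-] /ltW cA] := lb_ereal_inf_adherent en Afin.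
  by exists c.
pose V (i : nat * nat) := box_volume (c i.1 i.2).
apply: (@le_trans _ _ (\esum_(i in setT) V i)).
  apply: ereal_inf_lbound.
  have /card_esym/ppcard_eqP[f] := card_nat2.
  exists (fun k => c (f k).1 (f k).2).
    move=> t [i _ /(Pc i).1 [j _ ct]]; exists (f^-1%FUN (i, j)) => //.
    by rewrite /= invK ?inE.
  rewrite -(esum_pred_image V f xpredT) ?[fun=> _]set_true//.
    by rewrite image_eq.
  by move=> ? _; exact: box_volume_ge0.
have -> : \esum_(i in setT) V i =
    \sum_(i <oo) \sum_(j <oo) box_volume (c i j).
  pose J : nat -> set (nat * nat) := fun i => [set (i, j) | j in setT].
  rewrite (_ : setT = \bigcup_k J k); last first.
    by rewrite predeqE => -[a b]; split => // _; exists a => //; exists b.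
  rewrite esum_bigcupT /=; last 2 first.
    - apply/trivIsetP => i j _ _ ij.
      rewrite predeqE => -[n m] /=; split => //= -[] [_] _ [<-{n} _].
      by move=> [m' _] [] /esym/eqP; rewrite (negbTE ij).
    - by move=> i; exact: box_volume_ge0.
  rewrite -(image_id [set: nat]) -fun_true esum_pred_image//; last first.
    by move=> n _; apply: esum_ge0 => i _; exact: box_volume_ge0.
  apply: eq_eseriesr => /= j _.
  transitivity (\esum_(i in pair j @` [set: nat]) V i); first by congr esum.
  rewrite -(esum_pred_image V (pair j) xpredT).
  - by congr (esum (image _ _) _); apply/seteqP.
  - by move=> k _; exact: box_volume_ge0.
  - by move=> ? ? _ _ [].
apply: lee_nneseries => [n _ _|n _]; first exact: nneseries_ge0.
exact: (Pc n).2.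
Qed.

HB.instance Definition _ := isOuterMeasure.Build R 'rV[R]_N lebesgue_outer
  lebesgue_outer0 lebesgue_outer_ge0 le_lebesgue_outer
  lebesgue_outer_sigma_subadditive.

(* The sigma-algebra is that of Lebesgue (Caratheodory) measurable sets. *)
Definition Rn : Type := caratheodory_type lebesgue_outer.

HB.instance Definition _ := Measurable.copy Rn (caratheodory_type lebesgue_outer).

Definition leb : set Rn -> \bar R := lebesgue_outer.

HB.instance Definition _ := isMeasure.Build _ Rn R leb
  (@caratheodory_measure0 R 'rV[R]_N lebesgue_outer)
  (@caratheodory_measure_ge0 R 'rV[R]_N lebesgue_outer)
  (@caratheodory_measure_sigma_additive R 'rV[R]_N lebesgue_outer).

End lebesgue_measure_Rn.
Arguments Rn : clear implicits.
Arguments leb {R N}.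

Section lebesgue_space.
Context (R : realType) (N k : nat).
Implicit Types (W : set (Rn R N)) (p : R) (f : Rn R N -> 'rV[R]_k).

Definition dotv (u v : 'rV[R]_k) : R := \sum_i u 0 i * v 0 i.
Definition enorm (u : 'rV[R]_k) : R := Num.sqrt (dotv u u).

Definition Lp_norm W p f : \bar R :=
  'N[leb]_p%:E[(EFin \o (enorm \o f)) \_ W].

Definition in_Lp W p f :=
  (forall i, measurable_fun W (fun x => f x 0 i)) /\ (Lp_norm W p f < +oo)%E.

Section operator.
Context (X : normedModType R) (W : set (Rn R N)) (p : R).
Variable T : X -> Rn R N -> 'rV[R]_k.

(* [T u] is a representative of the image of [u], so linearity is up to
   almost everywhere equality. *)
Definition linear_to_Lp := (forall u, in_Lp W p (T u)) /\
  forall (a : R) u v,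
    {ae leb, forall x, W x -> T (a *: u + v) x = a *: T u x + T v x}.

Definition compact_to_Lp := forall w : nat -> X,
  (exists M, forall n, `|w n| <= M) ->
  exists s : nat -> nat, {homo s : m n / (m < n)%N} /\
  exists f, in_Lp W p f /\
    Lp_norm W p (fun x => T (w (s n)) x - f x) @[n --> \oo] --> 0%E.
End operator.

End lebesgue_space.

Section clarke.
Context (R : realType) (k : nat).
Implicit Types (g : 'rV[R]_k -> R) (y h z : 'rV[R]_k).

Definition clarke_deriv g y h : \bar R :=
  limf_esup (fun wl : 'rV[R]_k * R => ((g (wl.1 + wl.2 *: h) - g wl.1) / wl.2)%:E)
    (filter_prod (nbhs y) 0^'+).

Definition clarke_grad g y : set 'rV[R]_k :=
  [set z | forall h, ((dotv z h)%:E <= clarke_deriv g y h)%E].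

Definition locally_lipschitz g :=
  forall y, exists2 U, nbhs y U & [lipschitz (g z : R^o) | z in U].

End clarke.

(* Measurability in the first variable is with respect to Lebesgue measurable
   sets, and the functions are only relevant on [W]. *)
Definition caratheodory_function (R : realType) (N k : nat) (W : set (Rn R N))
    (j : Rn R N -> 'rV[R]_k -> R) :=
  (forall y, measurable_fun W (fun x => j x y)) /\
  {ae leb, forall x, W x -> continuous (j x)}.

Section set_valued.
Context (R : realType) (X : normedModType R).
Implicit Types (K : set X) (A : X -> set (dual X)).

Definition monotone_on K A := forall u v (us vs : dual X),
  K u -> K v -> A u us -> A v vs -> 0 <= (vs - us) (v - u).

Definition segment (a b : X) : set X :=
  [set (1 - t) *: a + t *: b | t in `[0, 1]].

Definition weak_star_cvg (us : nat -> dual X) (f : dual X) :=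
  forall v, us n v @[n --> \oo] --> f v.

Definition lower_hemicontinuous_on K A := forall a b,
  segment a b `<=` K ->
  forall u us (w : nat -> X), segment a b u -> A u us ->
    (forall n, segment a b (w n)) -> w n @[n --> \oo] --> u ->
  exists ws : nat -> dual X, (forall n, A (w n) (ws n)) /\ weak_star_cvg ws us.

Definition convex_efun (phi : X -> \bar R) := forall (t : R) (u v : X),
  0 <= t -> t <= 1 ->
  (phi (t *: u + (1 - t) *: v)%R <= t%:E * phi u + (1 - t)%:E * phi v)%E.

Definition edom (phi : X -> \bar R) : set X := [set u | (phi u < +oo)%E].

End set_valued.

(* When [phi] is [+oo] at [u], this is [-oo] for every [v], as [-oo] is absorbing
   for the addition of extended reals. *)
Definition hemivar (R : realType) (X : normedModType R) (N k : nat)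
    (W : set (Rn R N)) (phi : X -> \bar R) (T : X -> Rn R N -> 'rV[R]_k)
    (j : Rn R N -> 'rV[R]_k -> R) (u : X) (us : dual X) (v : X) : \bar R :=
  ((us (v - u)%R)%:E + phi v - phi u
   + \int[leb]_(x in W) clarke_deriv (j x) (T u x) (T v x - T u x)%R)%E.

(* Main.v *)
Require Import Defs.
From mathcomp Require Import all_boot all_order all_algebra.
From mathcomp Require Import all_classical all_reals all_analysis.
From mathcomp Require Import measurable_realfun ring lra.
Set Implicit Arguments.
Unset Strict Implicit.
Unset Printing Implicit Defensive.
Import Order.TTheory GRing.Theory Num.Theory.
Import numFieldNormedType.Exports.
Local Open Scope classical_set_scope.
Local Open Scope ring_scope.

(** Fix a solution [u] on the ball of radius [n] and view the left-hand side of
    the inequality as a function [F] of the test point [v]. It is convex: the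
    pairing is affine, [phi] is convex, and the integral is convex because
    Clarke's derivative is sublinear in its direction ([hemivar_convex]). Now
    suppose that [F w <= 0] at some [w] in [K] with norm less than [n]. For any
    [v] in [K], the points of the segment from [w] to [v] that are close to [w]
    lie in the ball, where [F] is nonnegative, and below the chord of [F]; so
    [F v] is nonnegative, and [u] solves the problem on all of [K]
    ([convex_chord_ge0]). When [u] is interior to the ball, [w = u] will do, as
    [F u = 0]; under the sign condition at [0], [w = 0] will do. Under the
    coercivity condition some [u n] is interior ([coercive_interior]):
    otherwise all norms are [n], and testing with [u0] bounds the pairing, along
    a subsequence, by a multiple of [n `^ p], which coercivity forbids. This
    bound holds because an affine function of the norm minorizes [phi], the
    integrand has growth of order [p], and compactness bounds [T] on a
    subsequence of the normalized solutions.

    Splitting the integral of a sum needs measurable and integrable integrands.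
    Open sets are Lebesgue measurable because half-spaces are
    ([caratheodory_halfspace]). The derivative is measurable along measurable
    functions because its upper limit may be taken over rational increments
    ([clarke_deriv_rat]), and a function that is measurable in one variable and
    continuous in the other can be composed with measurable functions
    ([measurable_superposition]). The growth condition bounds the generalized
    gradient; it bounds the derivative too, since by the Hahn-Banach theorem
    the derivative is the support function of the gradient
    ([clarke_deriv_attained]). *)

(** * Euclidean space *)

Section euclidean.
Context (R : realType) (k : nat).
Implicit Types u v w : 'rV[R]_k.

Lemma dotv0r u : dotv u 0 = 0.
Proof. by rewrite /dotv big1// => i _; rewrite mxE mulr0. Qed.

Lemma dotvC u v : dotv u v = dotv v u.
Proof. by apply: eq_bigr => i _; rewrite mulrC. Qed.

Lemma dotvDr u v w : dotv u (v + w) = dotv u v + dotv u w.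
Proof. by rewrite -big_split; apply: eq_bigr => i _; rewrite mxE mulrDr. Qed.

Lemma dotvZr (a : R) u v : dotv u (a *: v) = a * dotv u v.
Proof. by rewrite mulr_sumr; apply: eq_bigr => i _; rewrite mxE mulrCA. Qed.

Lemma dotvv_ge0 u : 0 <= dotv u u.
Proof. by apply: sumr_ge0 => i _; rewrite -expr2 sqr_ge0. Qed.

Lemma dotvv_eq0 u : dotv u u = 0 -> u = 0.
Proof.
move=> /eqP; rewrite psumr_eq0 => [/allP u0|i _]; last by rewrite -expr2 sqr_ge0.
apply/rowP => i; rewrite mxE.
by have := u0 i (mem_index_enum i); rewrite -expr2 sqrf_eq0 => /eqP.
Qed.

Lemma enorm_ge0 u : 0 <= enorm u.
Proof. exact: sqrtr_ge0. Qed.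

Lemma sqr_enorm u : enorm u ^+ 2 = dotv u u.
Proof. by rewrite sqr_sqrtr// dotvv_ge0. Qed.

Lemma enormN u : enorm (- u) = enorm u.
Proof.
congr Num.sqrt; rewrite -scaleN1r dotvZr dotvC dotvZr.
by rewrite mulrA mulrNN mulr1 mul1r.
Qed.

Lemma enormZ (a : R) u : enorm (a *: u) = `|a| * enorm u.
Proof.
rewrite /enorm dotvZr dotvC dotvZr mulrA -expr2 sqrtrM ?sqr_ge0//.
by rewrite sqrtr_sqr.
Qed.

Lemma dotv_le_enorm u v : dotv u v <= enorm u * enorm v.
Proof.
have [a0|a0] := eqVneq (enorm u) 0.
  rewrite a0 mul0r dotvC (_ : u = 0) ?dotv0r//.
  by apply: dotvv_eq0; rewrite -sqr_enorm a0 expr0n.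
have [b0|b0] := eqVneq (enorm v) 0.
  rewrite b0 mulr0 (_ : v = 0) ?dotv0r//.
  by apply: dotvv_eq0; rewrite -sqr_enorm b0 expr0n.
have ab : 0 < enorm u * enorm v by rewrite mulr_gt0// lt_def ?a0 ?b0 enorm_ge0.
(* The square norm of enorm v *: u - enorm u *: v is nonnegative. *)
have := dotvv_ge0 (enorm v *: u + (- enorm u) *: v).
have bil (a b : R) : dotv (a *: u + b *: v) (a *: u + b *: v) =
    a ^+ 2 * enorm u ^+ 2 + 2 * a * b * dotv u v + b ^+ 2 * enorm v ^+ 2.
  rewrite !sqr_enorm dotvDr !dotvZr ![dotv (_ + _) _]dotvC !dotvDr !dotvZr.
  by rewrite (dotvC v u); ring.
rewrite bil => H; rewrite -(ler_pM2l ab); nra.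
Qed.

Lemma ler_enormD u v : enorm (u + v) <= enorm u + enorm v.
Proof.
rewrite -(ler_pXn2r (n := 2))// ?nnegrE ?addr_ge0 ?enorm_ge0//.
rewrite sqrrD !sqr_enorm dotvDr ![dotv (_ + _) _]dotvC !dotvDr (dotvC v u).
by have := dotv_le_enorm u v; lra.
Qed.

End euclidean.

(** * Sublinear functionals on Euclidean space *)

Section sublinear.
Context (R : realType).

(** Homogeneity is asked as an inequality for positive factors only, the form in
    which infima and upper limits deliver it; equality is [sublinearZ]. *)
Definition sublinear (V : lmodType R) (P : V -> R) :=
  (forall x y, P (x + y) <= P x + P y) /\
  (forall c x, 0 < c -> P (c *: x) <= c * P x).

Lemma sublinear0 (V : lmodType R) (P : V -> R) : sublinear P -> P 0 = 0.
Proof.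
move=> [PD PZ]; have two_gt0 : 0 < 2 :> R by [].
have := PZ 2 0 two_gt0; have := PZ 2^-1 0; rewrite !scaler0 invr_gt0.
by move=> /(_ two_gt0); lra.
Qed.

Lemma sublinearZ (V : lmodType R) (P : V -> R) c x :
  sublinear P -> 0 <= c -> P (c *: x) = c * P x.
Proof.
move=> slP; rewrite le_eqVlt => /predU1P[<-|c0].
  by rewrite scale0r mul0r sublinear0.
apply/eqP; rewrite eq_le slP.2//= -ler_pdivlMl//.
by rewrite (le_trans _ (slP.2 _ _ _)) ?invr_gt0// scalerA mulVf ?gt_eqF// scale1r.
Qed.

Lemma sublinearN (V : lmodType R) (P : V -> R) x : sublinear P -> - P (- x) <= P x.
Proof.
by move=> slP; have := slP.1 x (- x); rewrite subrr sublinear0//; lra.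
Qed.

(** One step of the Hahn-Banach theorem: pushing a sublinear functional down
    along [e] as far as possible makes it linear on the line spanned by [e],
    without changing its value at [e]. *)
Lemma sublinear_linear_along (V : lmodType R) (P : V -> R) e : sublinear P ->
  exists2 Q : V -> R, sublinear Q & (forall x, Q x <= P x) /\ Q (- e) = - P e.
Proof.
move=> slP; have [PD PZ] := slP.
pose S x := [set P (x + t *: e) - t * P e | t in [set t | 0 <= t]].
have S0 x : S x !=set0 by exists (P (x + 0 *: e) - 0 * P e), 0 => //=.
have lbS x : lbound (S x) (- P (- x)).
  move=> _ [t /= t0 <-].
  by have := PD (x + t *: e) (- x); rewrite addrC addKr sublinearZ//; lra.
have Sle x t : 0 <= t -> inf (S x) <= P (x + t *: e) - t * P e.
  by move=> t0; apply: ge_inf; [exists (- P (- x))|exists t].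
have slQ : sublinear (fun x => inf (S x)).
  split=> [x y|c x c0].
    rewrite -lerBlDr; apply: lb_le_inf => // _ [t /= t0 <-].
    rewrite lerBlDr -lerBlDl; apply: lb_le_inf => // _ [s /= s0 <-].
    rewrite lerBlDl (le_trans (Sle _ _ (addr_ge0 s0 t0)))//.
    have := PD (y + s *: e) (x + t *: e).
    by rewrite addrACA -scalerDl (addrC y x); lra.
  rewrite -ler_pdivrMl//; apply: lb_le_inf => // _ [t /= t0 <-].
  rewrite ler_pdivrMl// (le_trans (Sle _ _ (mulr_ge0 (ltW c0) t0)))//.
  by have := PZ c (x + t *: e) c0; rewrite scalerDr scalerA; lra.
exists (fun x => inf (S x)) => //; have QP x : inf (S x) <= P x.
  by have := Sle x 0 (lexx _); rewrite scale0r addr0 mul0r subr0.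
split=> //; apply/eqP; rewrite eq_le; apply/andP; split.
  by have := Sle (- e) 1 ler01; rewrite scale1r addNr sublinear0// mul1r sub0r.
have : - inf (S e) <= inf (S (- e)).
  by have := sublinearN (- e) slQ; rewrite (opprK e).
by have := QP e; lra.
Qed.

(** The steps can be iterated, because a sublinear minorant keeps the linearity
    already gained: its values at [e] and [- e] can only decrease, while their
    sum stays nonnegative. *)
Lemma sublinear_linear_on_seq (V : lmodType R) (P : V -> R) (s : seq V) :
  sublinear P -> exists2 Q : V -> R, sublinear Q &
    (forall x, Q x <= P x) /\ forall e, e \in s -> Q (- e) = - Q e.
Proof.
elim: s P => [|e s IH] P slP; first by exists P.
have [Q0 slQ0 [Q0P Q0e]] := sublinear_linear_along e slP.
have [Q slQ [QQ0 Qs]] := IH _ slQ0; exists Q => //.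
split=> [x|x]; first exact: le_trans (QQ0 x) (Q0P x).
rewrite inE => /predU1P[->|/Qs//].
have := QQ0 (- e); have := QQ0 e; have := Q0P e; rewrite Q0e.
by have := sublinearN e slQ; lra.
Qed.

(** The Hahn-Banach theorem in Euclidean space: the functional is made linear
    first along [h], which fixes its value there, then along a basis. *)
Lemma sublinear_support k (P : 'rV[R]_k -> R) h : sublinear P ->
  exists2 z, (forall x, dotv z x <= P x) & dotv z h = P h.
Proof.
move=> slP; have [Q0 slQ0 [Q0P Q0h]] := sublinear_linear_along h slP.
have [Q slQ [QQ0 Qs]] := sublinear_linear_on_seq
  [seq delta_mx 0 i | i <- enum 'I_k] slQ0.
have Qd i (a : R) : Q (a *: delta_mx 0 i) = a * Q (delta_mx 0 i).
  have [a0|a0] := leP 0 a; first by rewrite sublinearZ.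
  rewrite -[a in LHS]opprK scaleNr -scalerN sublinearZ ?oppr_ge0 ?ltW//.
  by rewrite Qs ?mulrNN// map_f// mem_enum.
have Qle x : Q x <= dotv (\row_i Q (delta_mx 0 i)) x.
  rewrite [in leLHS](row_sum_delta x).
  have -> : dotv (\row_i Q (delta_mx 0 i)) x = \sum_i Q (x 0 i *: delta_mx 0 i).
    by apply: eq_bigr => i _; rewrite mxE Qd mulrC.
  elim/big_ind2 : _ => [|a b c d ab cd|//]; first by rewrite sublinear0.
  by rewrite (le_trans (slQ.1 _ _))// lerD.
have QE x : Q x = dotv (\row_i Q (delta_mx 0 i)) x.
  apply/eqP; rewrite eq_le Qle/=.
  have := Qle (- x); rewrite -scaleN1r dotvZr scaleN1r.
  by have := sublinearN x slQ; lra.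
exists (\row_i Q (delta_mx 0 i)) => [x|]; rewrite -QE.
  exact: le_trans (QQ0 x) (Q0P x).
have := QQ0 (- h); have := QQ0 h; have := Q0P h; rewrite Q0h.
by have := sublinearN h slQ; lra.
Qed.

End sublinear.

(** * Clarke's directional derivative *)

Section clarke_derivative.
Context (R : realType) (k : nat) (g : 'rV[R]_k -> R).
Implicit Types (y h w : 'rV[R]_k) (l d : R).

Let dq w l h := (g (w + l *: h) - g w) / l.

Lemma clarke_deriv_lt y h c : (clarke_deriv g y h < c)%E ->
  exists2 d, 0 < d &
    forall w l, ball y d w -> 0 < l < d -> ((dq w l h)%:E < c)%E.
Proof.
move=> /ereal_inf_lt[_ [V [[A B] [/= yA B0] ABV] <-] Vc].
have /nbhs_ballP[d1 /= d10 d1A] := yA.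
have /nbhs_ballP[d2 /= d20 d2B] := B0.
exists (Num.min d1 d2) => [|w l yw /andP[l0 ld]]; first by rewrite lt_min d10.
apply: le_lt_trans Vc; apply: ereal_sup_ubound; exists (w, l) => //.
apply: ABV; split=> /=.
  by apply: d1A; apply: le_ball yw; rewrite ge_min lexx.
apply: d2B => //=; rewrite /ball/= sub0r normrN gtr0_norm//.
by rewrite (lt_le_trans ld)// ge_min lexx orbT.
Qed.

Lemma clarke_deriv_le y h c d : 0 < d ->
  (forall w l, ball y d w -> 0 < l < d -> ((dq w l h)%:E <= c)%E) ->
  (clarke_deriv g y h <= c)%E.
Proof.
move=> d0 H; apply: ge_ereal_inf.
exists (ereal_sup [set ((dq wl.1 wl.2 h)%:E) | wl in ball y d `*` `]0, d[%classic]).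
  exists (ball y d `*` `]0, d[%classic) => //.
  exists (ball y d, `]0, d[%classic) => //=; split; first exact: nbhsx_ballx.
  by apply/nbhs_ballP; exists d => //= l; rewrite /ball/= sub0r normrN => ld l0;
    rewrite in_itv/= l0 -(gtr0_norm l0).
by apply: ge_ereal_sup => _ [[w l] /= [yw +] <-]; rewrite in_itv/=; exact: H.
Qed.

Lemma locally_lipschitz_ball y : locally_lipschitz g ->
  exists L d, [/\ 0 <= L, 0 < d &
    forall a b, ball y d a -> ball y d b -> `|g a - g b| <= L * `|a - b|].
Proof.
move=> /(_ y)[U /nbhs_ballP[d /= d0 dU]] gU.
have [L [L0 LU]] := pinfty_ex_gt0 gU.
exists L, d; split => // [|a b ya yb]; first exact: ltW.
by have /= := LU (a, b); apply; split; exact: dU.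
Qed.

Lemma clarke_deriv_le_norm y : locally_lipschitz g ->
  exists2 L, 0 <= L & forall h, (clarke_deriv g y h <= (L * `|h|)%:E)%E.
Proof.
move=> /(locally_lipschitz_ball y)[L [d [L0 d0 gL]]]; exists L => // h.
have h1 : 0 < 1 + `|h| by rewrite ltr_pwDl.
have dh : d / (1 + `|h|) <= d.
  by rewrite ler_pdivrMr// ler_peMr ?(ltW d0)// lerDl.
apply: (@clarke_deriv_le _ _ _ (d / (1 + `|h|))) => [|w l yw /andP[l0 ld]].
  exact: divr_gt0.
rewrite lee_fin ler_pdivrMr// (le_trans (ler_norm _))//.
have -> : L * `|h| * l = L * `|(w + l *: h) - w|.
  by rewrite addrC addKr normrZ gtr0_norm// -mulrA (mulrC l).
apply: gL; last exact: le_ball yw.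
move: yw; rewrite -ball_normE /ball_/= => yw.
rewrite opprD addrA (le_lt_trans (ler_normB _ _))// normrZ (gtr0_norm l0).
rewrite -[ltRHS](@divfK _ (1 + `|h|)) ?gt_eqF// [ltRHS]mulrDr mulr1.
by rewrite ltr_leD// ler_wpM2r// ltW.
Qed.

(* Stated with strict real upper bounds so as to apply before the derivative is
   known to be finite. *)
Let clarke_derivD_lt y h1 h2 c1 c2 : (clarke_deriv g y h1 < c1%:E)%E ->
  (clarke_deriv g y h2 < c2%:E)%E ->
  (clarke_deriv g y (h1 + h2) <= (c1 + c2)%:E)%E.
Proof.
move=> /clarke_deriv_lt[d1 d10 H1] /clarke_deriv_lt[d2 d20 H2].
pose d := Num.min (d1 / (1 + `|h2|)) d2.
have h20 : 0 < 1 + `|h2| by rewrite ltr_pwDl.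
have dd2 : d <= d2 by rewrite ge_min lexx orbT.
have dd1 : d * (1 + `|h2|) <= d1 by rewrite -ler_pdivlMr// ge_min lexx.
have d0 : 0 < d by rewrite lt_min d20 divr_gt0.
apply: (@clarke_deriv_le _ _ _ d) => // w l yw /andP[l0 ld].
(* The quotient along h1 is taken at the base point shifted by l *: h2, which is
   why the upper limit must let the base point vary. *)
have := H1 (w + l *: h2) l; have := H2 w l.
rewrite l0 !lte_fin !lee_fin (lt_le_trans ld dd2) (lt_le_trans ld)/=; last first.
  by rewrite (le_trans _ dd1)// ler_peMr ?(ltW d0)// lerDl.
move=> /(_ (le_ball dd2 yw) isT) q2 /(_ _ isT) q1.
have {q1} q1 : dq (w + l *: h2) l h1 < c1.
  apply: q1; move: yw; rewrite -!ball_normE /ball_/= => yw.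
  rewrite opprD addrA (le_lt_trans (ler_normB _ _))// normrZ (gtr0_norm l0).
  by rewrite (lt_le_trans _ dd1)// mulrDr mulr1 ltr_leD// ler_wpM2r// ltW.
have -> : dq w l (h1 + h2) = dq (w + l *: h2) l h1 + dq w l h2.
  rewrite /dq -mulrDl scalerDr addrA [w + l *: h1 + _]addrAC.
  by rewrite addrA subrK.
by rewrite lerD// ltW.
Qed.

Let clarke_deriv0_ge0 y : (0 <= clarke_deriv g y 0)%E.
Proof.
rewrite leNgt; apply/negP => /clarke_deriv_lt[d d0 /(_ y (d / 2))].
rewrite /dq scaler0 addr0 subrr mul0r lte_fin ltxx divr_gt0//=.
rewrite ltr_pdivrMr// ltr_pMr// ltr1n => /(_ (ballxx _ d0) isT).
by [].
Qed.

(** The Lipschitz bound excludes [+oo]. A value [-oo] at [h] would, by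
    subadditivity with [- h], make the derivative along [0] negative. *)
Lemma clarke_deriv_fin_num y h : locally_lipschitz g ->
  clarke_deriv g y h \is a fin_num.
Proof.
move=> /(clarke_deriv_le_norm y)[L L0 gL].
rewrite fin_numE; apply/andP; split; apply/eqP => gh; last first.
  by have := gL h; rewrite gh.
have h1 : (clarke_deriv g y h < (- (L * `|h| + 2))%:E)%E by rewrite gh ltNyr.
have h2 : (clarke_deriv g y (- h) < (L * `|h| + 1)%:E)%E.
  by rewrite (le_lt_trans (gL _))// normrN lte_fin ltrDl.
have := clarke_derivD_lt h1 h2; rewrite subrr.
by move=> /(le_trans (clarke_deriv0_ge0 y)); rewrite lee_fin; lra.
Qed.

Definition rclarke_deriv y h : R := fine (clarke_deriv g y h).

Lemma clarke_derivE y h : locally_lipschitz g ->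
  clarke_deriv g y h = (rclarke_deriv y h)%:E.
Proof. by move=> gL; rewrite fineK// clarke_deriv_fin_num. Qed.

Lemma sublinear_clarke_deriv y : locally_lipschitz g ->
  sublinear (rclarke_deriv y).
Proof.
move=> gL; split=> [h1 h2|c h c0].
  apply/ler_addgt0Pr => e e0.
  have lt_e h : (clarke_deriv g y h < (rclarke_deriv y h + e / 2)%:E)%E.
    by rewrite clarke_derivE// lte_fin ltrDl divr_gt0.
  have := clarke_derivD_lt (lt_e h1) (lt_e h2).
  by rewrite clarke_derivE// lee_fin; lra.
apply/ler_addgt0Pr => e e0.
have : (clarke_deriv g y h < (rclarke_deriv y h + e / c)%:E)%E.
  by rewrite clarke_derivE// lte_fin ltrDl divr_gt0.
move=> /clarke_deriv_lt[d d0 H].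
pose d' := Num.min d (d / c).
have d'0 : 0 < d' by rewrite lt_min d0 divr_gt0.
rewrite -lee_fin -clarke_derivE//.
apply: (@clarke_deriv_le _ _ _ d') => // w l yw /andP[l0].
rewrite lt_min => /andP[ld ldc].
have := H w (c * l); rewrite mulr_gt0//= mulrC -ltr_pdivlMr// ldc.
have yw' : ball y d w by apply: le_ball yw; rewrite ge_min lexx.
move=> /(_ yw' isT); rewrite !lte_fin lee_fin => q.
have -> : dq w l (c *: h) = c * dq w (l * c) h.
  by rewrite /dq scalerA; field; rewrite !gt_eqF.
by move/ltW: q; rewrite -(ler_pM2l c0) mulrDr (mulrCA c e) divff ?gt_eqF// mulr1.
Qed.

(** The upper bound that defines the generalized gradient is sharp: a linear
    functional that supports the derivative at [h] belongs to the gradient. *)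
Lemma clarke_deriv_attained y h : locally_lipschitz g ->
  exists2 z, clarke_grad g y z & dotv z h = rclarke_deriv y h.
Proof.
move=> gL; have [z zle zh] := sublinear_support h (sublinear_clarke_deriv y gL).
by exists z => // h'; rewrite clarke_derivE// lee_fin.
Qed.

(** The lower bound follows from the upper one along [- h], by sublinearity. *)
Lemma norm_clarke_deriv_le y h M : locally_lipschitz g ->
  (forall z, clarke_grad g y z -> enorm z <= M) ->
  `|rclarke_deriv y h| <= M * enorm h.
Proof.
move=> gL gM.
have ub h' : rclarke_deriv y h' <= M * enorm h'.
  have [z /gM zM <-] := clarke_deriv_attained y h' gL.
  by rewrite (le_trans (dotv_le_enorm _ _))// ler_wpM2r// enorm_ge0.
rewrite ler_norml ub andbT; have := ub (- h); rewrite enormN.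
by have := sublinearN h (sublinear_clarke_deriv y gL); lra.
Qed.

End clarke_derivative.

(** * Measurability of the directional derivative along measurable functions *)

Lemma rV_rat_approx (R : realType) k (w : 'rV[R]_k) (e : R) : 0 < e ->
  exists r : 'rV[rat]_k, ball w e (map_mx ratr r).
Proof.
move=> e0.
have /choice[q wq] : forall i, exists q : rat, ball (w 0 i) e (ratr q).
  move=> i; have : w 0 i - e < w 0 i + e by lra.
  move=> /rat_in_itvoo[q]; rewrite in_itv/= => /andP[q1 q2]; exists q.
  by rewrite /ball/= ltr_norml; apply/andP; split; lra.
exists (\row_i q i); split=> // a i.
by rewrite !mxE ord1; exact: wq.
Qed.

Section superposition.
Context d (T : measurableType d) (R : realType) (k : nat) (D : set T).
Context (j : T -> 'rV[R]_k -> R).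

Let grid (m : nat) (z : 'rV[int]_k) : 'rV[R]_k := \row_i ((z 0 i)%:~R / m.+1%:R).

Let grid_floor m (a : 'rV[R]_k) := \row_i Num.floor (m.+1%:R * a 0 i).

Let grid_approx m (a : 'rV[R]_k) (e : R) : 0 < e -> m.+1%:R^-1 < e ->
  ball a e (grid m (grid_floor m a)).
Proof.
move=> e0 me; split=> // b i; rewrite !mxE ord1.
have m0 : 0 < m.+1%:R :> R by [].
have := floor_itv (m.+1%:R * a 0 i); set z := Num.floor _.
rewrite intrD => /andP[z1 z2]; rewrite /ball/=.
have -> : a 0 i - z%:~R / m.+1%:R = (m.+1%:R * a 0 i - z%:~R) / m.+1%:R.
  by rewrite mulrBl mulrAC divff ?mul1r// gt_eqF.
rewrite normrM normfV (gtr0_norm m0) ger0_norm ?subr_ge0//.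
by rewrite (le_lt_trans _ me)// ler_piMl ?invr_ge0 ?ltW//; lra.
Qed.

(** A function that is measurable in the first variable and continuous in the
    second is the pointwise limit of its compositions with discretizations of
    the inner function, each of which takes countably many values. *)
Lemma measurable_superposition (a : T -> 'rV[R]_k) :
  (forall y, measurable_fun D (j ^~ y)) -> (forall x, D x -> continuous (j x)) ->
  (forall i, measurable_fun D (fun x => a x 0 i)) ->
  measurable_fun D (fun x => j x (a x)).
Proof.
move=> mj cj ma.
apply: (measurable_fun_cvg
    (h := fun m x => j x (grid m (grid_floor m (a x))))) => [m mD Y mY|x Dx].
  rewrite [X in measurable X](_ : _ = \bigcup_z
    ([set x | D x /\ grid_floor m (a x) = z] `&`
     (D `&` (fun x => j x (grid m z)) @^-1` Y))); last first.
    apply/seteqP; split=> [x [Dx Yx]|x [z _ [[_ <-] [Dx Yx]]]] //.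
    by exists (grid_floor m (a x)).
  apply: countable_bigcupT_measurable => [|z]; first exact: countableP.
  apply: measurableI; last exact: mj.
  rewrite [X in measurable X](_ : _ = D `&` \bigcap_(i in [set: 'I_k])
    (D `&` (fun x => a x 0 i) @^-1`
       `[(z 0 i)%:~R / m.+1%:R, (z 0 i + 1)%:~R / m.+1%:R[%classic)); last first.
    have m0 : 0 < m.+1%:R :> R by [].
    apply/seteqP; split=> [x /= [Dx zE]|x /= [Dx zi]]; split=> //.
      move=> i _; split=> //=; rewrite in_itv/= ler_pdivrMr// ltr_pdivlMr//.
      by rewrite -zE !mxE [_ * m.+1%:R]mulrC; exact: floor_itv.
    apply/rowP => i; rewrite mxE; apply/floor_def.
    have [_] /= := zi i I; rewrite in_itv/= ler_pdivrMr// ltr_pdivlMr//.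
    by rewrite mulrC.
  apply: measurableI => //; apply: fin_bigcap_measurable => // i _.
  exact: ma.
apply: (cvg_comp (fun m => grid m (grid_floor m (a x)))); last exact: cj.
apply/cvg_ballP => e e0; near=> m; apply: grid_approx => //.
near: m; exact: near_infty_natSinv_lt (PosNum e0).
Unshelve. all: by end_near. Qed.

End superposition.

Lemma continuous_locally_lipschitz (R : realType) k (g : 'rV[R]_k -> R) :
  locally_lipschitz g -> continuous g.
Proof.
move=> gL y; have [L [d [L0 d0 Ld]]] := locally_lipschitz_ball y gL.
apply/(cvgrPdist_lt (FF := nbhs_filter y)) => e e0.
have L1 : 0 < L + 1 by rewrite ltr_wpDl.
near=> z; have yz : ball y (Num.min d (e / (L + 1))) z.
  by near: z; apply: nbhsx_ballx; rewrite lt_min d0 divr_gt0.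
have yzd : ball y d z by apply: le_ball yz; rewrite ge_min lexx.
have yze : `|y - z| < e / (L + 1).
  by move: yz; rewrite -ball_normE /ball_/= lt_min => /andP[].
rewrite (le_lt_trans (Ld _ _ (ballxx _ d0) yzd))//.
rewrite (@le_lt_trans _ _ ((L + 1) * `|y - z|)) ?ler_wpM2r// ?lerDl//.
by rewrite mulrC -ltr_pdivlMr.
Unshelve. all: by end_near. Qed.

Section clarke_deriv_countable.
Context (R : realType) (k : nat).

(** An enumeration by [m] of the quotients with rational increments of size less
    than [n.+1%:R^-1]; the codes of no such increment get [-oo], which leaves the
    supremum unchanged. *)
Definition rat_quotient (g : 'rV[R]_k -> R) (y h : 'rV[R]_k) (n m : nat) : \bar R :=
  if unpickle m is Some (r, l) then
    let r' : 'rV[R]_k := map_mx ratr r in let l' : R := ratr l in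
    if (`|r'| < n.+1%:R^-1) && (0 < l' < n.+1%:R^-1) then
      ((g (y + r' + l' *: h) - g (y + r')) / l')%:E
    else -oo%E
  else -oo%E.

(** As [g] is continuous, rational increments suffice in the upper limit, which
    thus becomes a countable infimum of countable suprema. *)
Lemma clarke_deriv_rat (g : 'rV[R]_k -> R) y h : locally_lipschitz g ->
  clarke_deriv g y h = einfs (fun n => esups (rat_quotient g y h n) 0%N) 0%N.
Proof.
move=> gL; have cg := continuous_locally_lipschitz gL.
have sdropT (s : (\bar R)^nat) : sdrop s 0%N = range s.
  by apply/seteqP; split=> _ [m _ <-]; exists m.
rewrite /einfs /esups/= sdropT; apply/eqP; rewrite eq_le; apply/andP; split.
  apply: le_ereal_inf_tmp => _ [n _ <-]; rewrite sdropT.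
  have n0 : 0 < n.+1%:R^-1 :> R by rewrite invr_gt0.
  apply: (clarke_deriv_le n0) => w l yw /andP[l0 ln]; rewrite leNgt.
  apply/negP => supq.
  have [c supc cq] : exists2 c,
      (ereal_sup (range (rat_quotient g y h n)) <= c%:E)%E &
      c < (g (w + l *: h) - g w) / l.
    move: supq; case: (ereal_sup _) => [c|//|_]; first by exists c.
    by exists ((g (w + l *: h) - g w) / l - 1); [exact: leNye|lra].
  (* The quotient is continuous at (w, l), so it still exceeds c at a rational
     increment. *)
  have cvq : (g (wl.1 + wl.2 *: h) - g wl.1) / wl.2 @[wl --> (w, l)] -->
      (g (w + l *: h) - g w) / l.
    apply: cvgM; last by apply: cvgV; [rewrite gt_eqF|exact: cvg_snd].
    apply: cvgB; last by apply: (cvg_comp fst g _ (cg w)); exact: cvg_fst.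
    apply: (cvg_comp (fun wl : 'rV[R]_k * R => wl.1 + wl.2 *: h)); last exact: cg.
    by apply: cvgD; [exact: cvg_fst|apply: cvgZr_tmp; exact: cvg_snd].
  have [[A B] [/= /nbhs_ballP[e1 /= e10 e1A] /nbhs_ballP[e2 /= e20 e2B] AB]] :=
    cvgr_gt _ cvq _ cq.
  move: yw; rewrite -ball_normE /ball_/= => yw.
  have [r ryw] := @rV_rat_approx R k (w - y)
    (Num.min e1 (n.+1%:R^-1 - `|y - w|)) ltac:(by rewrite lt_min e10 subr_gt0).
  have [q] : exists q, ratr q \in `]Num.max 0 (l - e2), Num.min (l + e2) n.+1%:R^-1[.
    apply: rat_in_itvoo; rewrite gt_max !lt_min n0 !andbT.
    by rewrite (lt_trans l0) ?ltrDl//= ltrBlDr -addrA ltrDl addr_gt0 //=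
      (lt_trans _ ln)// gtrBl.
  rewrite in_itv/= gt_max lt_min => /andP[/andP[q0 lq] /andP[ql qn]].
  suff : (c%:E < rat_quotient g y h n (pickle (r, q)))%E.
    apply/negP; rewrite -leNgt; apply: le_trans supc.
    by apply: ereal_sup_ubound; exists (pickle (r, q)).
  move: ryw; rewrite -ball_normE /ball_/= lt_min => /andP[re1 rn].
  rewrite /rat_quotient pickleK/= q0 qn !andbT ifT.
    rewrite lte_fin; apply: (AB (y + map_mx ratr r, ratr q)); split => /=.
      by apply: e1A; rewrite -ball_normE /ball_/= opprD addrA.
    by apply: e2B; rewrite /ball/= ltr_norml; apply/andP; split; lra.
  rewrite -(subrK (w - y) (map_mx ratr r)) (le_lt_trans (ler_normD _ _))//.
  by rewrite distrC (distrC w) -ltrBrDr.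
apply/lee_addgt0Pr => e e0.
have : (clarke_deriv g y h < clarke_deriv g y h + e%:E)%E.
  by rewrite (clarke_derivE _ _ gL) lte_fin ltrDl.
move=> /clarke_deriv_lt[d d0 H].
have [n nd] : exists n, n.+1%:R^-1 < d.
  by have [n _ nd] := near_infty_natSinv_lt (PosNum d0); exists n; exact: (nd n (leqnn n)).
apply: ge_ereal_inf; exists (ereal_sup (range (rat_quotient g y h n))).
  by exists n => //; rewrite sdropT.
apply: ge_ereal_sup => _ [m _ <-]; rewrite /rat_quotient.
case: unpickle => [[r l]|]; last exact: leNye.
case: ifPn => [/andP[rn /andP[l0 ln]]|_]; last exact: leNye.
apply/ltW/H; last by rewrite l0 (lt_trans ln).
by rewrite -ball_normE /ball_/= opprD addrA subrr sub0r normrN (lt_trans rn).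
Qed.

End clarke_deriv_countable.

Lemma measurable_clarke_deriv d (T : measurableType d) (R : realType) (k : nat)
    (D : set T) (j : T -> 'rV[R]_k -> R) (a b : T -> 'rV[R]_k) :
  (forall y, measurable_fun D (j ^~ y)) ->
  (forall x, D x -> locally_lipschitz (j x)) ->
  (forall i, measurable_fun D (fun x => a x 0 i)) ->
  (forall i, measurable_fun D (fun x => b x 0 i)) ->
  measurable_fun D (fun x => clarke_deriv (j x) (a x) (b x)).
Proof.
move=> mj jL ma mb.
apply: (eq_measurable_fun (fun x =>
  einfs (fun n => esups (rat_quotient (j x) (a x) (b x) n) 0%N) 0%N)).
  by move=> x; rewrite inE => /jL Lj; rewrite -clarke_deriv_rat.
apply: (measurable_fun_einfs
  (f := fun n x => esups (rat_quotient (j x) (a x) (b x) n) 0%N)) => n.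
apply: (measurable_fun_esups
  (f := fun m x => rat_quotient (j x) (a x) (b x) n m)) => m.
rewrite /rat_quotient.
case: (unpickle m : option ('rV[rat]_k * rat)) => [[r l]|];
  last exact: measurable_cst.
set small := (_ && _); case: small; last exact: measurable_cst.
have cj x : D x -> continuous (j x) by move=> /jL /continuous_locally_lipschitz.
apply/measurable_EFinP; apply: measurable_funM; last exact: measurable_cst.
apply: measurable_funB; apply: measurable_superposition => // i.
  under eq_fun do rewrite !mxE.
  apply: measurable_funD; last by apply: measurable_funM.
  by apply: measurable_funD.
by under eq_fun do rewrite !mxE; apply: measurable_funD.
Qed.

(** * Lebesgue measurability and finite measure of bounded open sets *)

Section lebesgue_sets.
Context (R : realType) (N : nat).

Let cut_le (i : 'I_N) (c : R) (o : option ('rV[R]_N * 'rV[R]_N)) :=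
  if o is Some (a, b) then
    Some (a, \row_l if l == i then Num.min (b 0 l) c else b 0 l)
  else None.

Let cut_gt (i : 'I_N) (c : R) (o : option ('rV[R]_N * 'rV[R]_N)) :=
  if o is Some (a, b) then
    Some (\row_l if l == i then Num.max (a 0 l) c else a 0 l, b)
  else None.

Let box_cut_le i c o : box o `&` [set x | x 0 i <= c] `<=` box (cut_le i c o).
Proof.
case: o => [[a b] x [/= xab xc] l|x []//]; rewrite mxE.
have /andP[-> xb] := xab l.
by case: eqP xb => [->|//] xb; rewrite le_min xb.
Qed.

Let box_cut_gt i c o : box o `&` ~` [set x | x 0 i <= c] `<=` box (cut_gt i c o).
Proof.
case: o => [[a b] x [/= xab /negP xc] l|x []//]; rewrite mxE.
have /andP[ax ->] := xab l; rewrite andbT.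
by case: eqP ax => [->|//] ax; rewrite gt_max ax ltNge.
Qed.

Let box_volume_cut i c (o : option ('rV[R]_N * 'rV[R]_N)) :
  (box_volume (cut_le i c o) + box_volume (cut_gt i c o) = box_volume o)%E.
Proof.
case: o => [[a b]|]; last by rewrite adde0.
rewrite /= -EFinD; congr (_%:E); rewrite (bigD1 i)//=.
rewrite [X in _ + X = _](bigD1 i)//= [RHS](bigD1 i)//= !mxE eqxx.
rewrite [X in _ * X + _](eq_bigr (fun l => Num.max 0 (b 0 l - a 0 l))); last first.
  by move=> l /negbTE li; rewrite mxE li.
rewrite [X in _ + _ * X](eq_bigr (fun l => Num.max 0 (b 0 l - a 0 l))); last first.
  by move=> l /negbTE li; rewrite mxE li.
rewrite -mulrDl; congr (_ * _); rewrite !maxEle !minEle.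
by do ! case: ifPn => //; lra.
Qed.

(** The hyperplane cuts every box of a cover into two boxes whose volumes add up
    to that of the box. *)
Lemma caratheodory_halfspace (i : 'I_N) (c : R) :
  (@lebesgue_outer R N).-caratheodory [set x | x 0 i <= c].
Proof.
apply: le_caratheodory_measurable => X.
apply: le_ereal_inf_tmp => _ [cs Xcs <-].
have -> : (\sum_(n <oo) box_volume (cs n) =
    \sum_(n <oo) box_volume (cut_le i c (cs n)) +
    \sum_(n <oo) box_volume (cut_gt i c (cs n)))%E.
  rewrite -nneseriesD => [|n _ _|n _ _]; try exact: box_volume_ge0.
  by apply: eq_eseriesr => n _; rewrite box_volume_cut.
apply: leeD; apply: ereal_inf_lbound.
  exists (cut_le i c \o cs) => // x [/Xcs[n _ csn] xc].
  by exists n => //; apply: box_cut_le.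
exists (cut_gt i c \o cs) => // x [/Xcs[n _ csn] xc].
by exists n => //; apply: box_cut_gt.
Qed.

Lemma measurable_box (a b : 'rV[R]_N) : measurable (box (Some (a, b)) : set (Rn R N)).
Proof.
have mH i c : measurable ([set x | x 0 i <= c] : set (Rn R N)).
  exact: caratheodory_halfspace.
rewrite (_ : box _ = \bigcap_(i in [set: 'I_N])
    (~` [set x : 'rV[R]_N | x 0 i <= a 0 i] `&` [set x | x 0 i <= b 0 i])); last first.
  apply/seteqP; split=> x /= xab i => [_|].
    by have /andP[ax xb] := xab i; split=> //=; apply/negP; rewrite -ltNge.
  by have [/negP] := xab i I; rewrite -ltNge => -> ->.
apply: fin_bigcap_measurable => // i _.
by apply: measurableI; [apply: measurableC|]; exact: mH.
Qed.

(** An open set is the countable union of the boxes with rational corners that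
    it contains. *)
Lemma open_measurable_Rn (W : set 'rV[R]_N) : open W -> measurable (W : set (Rn R N)).
Proof.
move=> oW.
pose rbox (c : 'rV[rat]_N * 'rV[rat]_N) : set 'rV[R]_N :=
  box (Some (map_mx ratr c.1, map_mx ratr c.2)).
rewrite (_ : W = \bigcup_c if `[< rbox c `<=` W >] then rbox c else set0); last first.
  apply/seteqP; split=> x => [Wx|[c _]]; last by case: asboolP => // cW /cW.
  have /nbhs_ballP[e /= e0 eW] : nbhs x W by exact: open_nbhs_nbhs.
  have e2 : 0 < e / 2 by rewrite divr_gt0.
  (* The corners are sought near x shifted by e / 2 along the diagonal, so that
     they lie strictly on either side of x. *)
  have [a [_ xa]] := rV_rat_approx (x - const_mx (e / 2)) e2.
  have [b [_ xb]] := rV_rat_approx (x + const_mx (e / 2)) e2.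
  have {}xa i : - e < ratr (a 0 i) - x 0 i < 0.
    have := xa 0 i; rewrite !mxE /ball/= ltr_norml => /andP[? ?].
    by apply/andP; split; lra.
  have {}xb i : 0 < ratr (b 0 i) - x 0 i < e.
    have := xb 0 i; rewrite !mxE /ball/= ltr_norml => /andP[? ?].
    by apply/andP; split; lra.
  exists (a, b) => //; rewrite asboolT => [i|z /= zab].
    rewrite !mxE; have /andP[? ?] := xa i; have /andP[? ?] := xb i.
    by apply/andP; split; lra.
  apply: eW; split=> // r i; rewrite ord1.
  have := zab i; rewrite !mxE => /andP[? ?].
  have /andP[? ?] := xa i; have /andP[? ?] := xb i.
  by rewrite /ball/= ltr_norml; apply/andP; split; lra.
apply: countable_bigcupT_measurable => [|c]; first exact: countableP.
by case: asboolP => _; [exact: measurable_box|exact: measurable0].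
Qed.

Lemma leb_bounded_lty (W : set 'rV[R]_N) : bounded_set W -> (leb (W : set (Rn R N)) < +oo)%E.
Proof.
move=> /pinfty_ex_gt0[M M0 WM].
pose c (n : nat) : option ('rV[R]_N * 'rV[R]_N) :=
  if n is 0%N then Some (const_mx (- (M + 1)), const_mx (M + 1)) else None.
apply: (@le_lt_trans _ _ (\sum_(n <oo) box_volume (c n))%E).
  apply: ereal_inf_lbound; exists c => // x Wx; exists 0%N => //= i; rewrite !mxE.
  have : `|x 0 i| <= M.
    apply: le_trans (WM _ Wx); rewrite [leRHS]/Num.norm /= mx_normrE.
    by apply/bigmax_geP; right => /=; exists (0, i).
  by rewrite ler_norml => /andP[? ?]; apply/andP; split; lra.
rewrite (nneseries_split 0%N 1%N) => [|n _]; last exact: box_volume_ge0.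
rewrite add0n big_nat1 eseries0 ?adde0 ?ltry// => n n1 _.
by case: n n1.
Qed.

End lebesgue_sets.

(** * Lebesgue spaces of vector-valued functions *)

(** Absorbs the growth of the generalized gradient: with the largest of [1],
    [a], [c] as [x], the left-hand side is at most [4 * x `^ p]. *)
Lemma growth_le (R : realType) (p a c : R) : 1 < p -> 0 <= a -> 0 <= c ->
  (1 + a `^ (p - 1)) * (a + c) <= 4 * (1 + a `^ p + c `^ p).
Proof.
move=> p1 a0 c0; pose x := Num.max 1 (Num.max a c).
have x1 : 1 <= x by rewrite le_max lexx.
have ax : a <= x by rewrite !le_max lexx orbT.
have cx : c <= x by rewrite !le_max lexx !orbT.
have x0 : 0 <= x by apply: le_trans x1.
have xp1 : 1 <= x `^ (p - 1).
  by rewrite -[leLHS](powRr0 x) ler_powR// subr_ge0 ltW.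
have ap : a `^ (p - 1) <= x `^ (p - 1).
  by apply: ge0_ler_powR; rewrite ?nnegrE//; lra.
have xp : x `^ p <= 1 + a `^ p + c `^ p.
  have ? := powR_ge0 a p; have ? := powR_ge0 c p.
  rewrite {1}/x maxEle; case: ifPn => _; last by rewrite powR1; lra.
  by rewrite maxEle; case: ifPn => _; lra.
apply: le_trans (_ : 4 * x `^ p <= _); last by rewrite ler_wpM2l.
have := powR_ge0 a (p - 1).
rewrite -(@mulr_powRB1 _ x p)//; last by lra.
move=> b0; rewrite (_ : 4 * (x * _) = (2 * x `^ (p - 1)) * (2 * x)); last by ring.
by apply: ler_pM; lra.
Qed.

Lemma powR_enormD (R : realType) k (p : R) (v w : 'rV[R]_k) : 0 <= p ->
  enorm (v + w) `^ p <= 2 `^ p * (enorm v `^ p + enorm w `^ p).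
Proof.
move=> p0; have v0 := enorm_ge0 v; have w0 := enorm_ge0 w.
have vw : enorm (v + w) <= 2 * Num.max (enorm v) (enorm w).
  by rewrite (le_trans (ler_enormD _ _))// maxEle; case: ifPn; lra.
apply: le_trans (_ : (2 * Num.max (enorm v) (enorm w)) `^ p <= _).
  by apply: ge0_ler_powR; rewrite ?nnegrE// ?enorm_ge0// (le_trans _ vw)// enorm_ge0.
rewrite powRM//; last by rewrite le_max v0.
rewrite ler_wpM2l ?powR_ge0//.
have ? := powR_ge0 (enorm v) p; have ? := powR_ge0 (enorm w) p.
by rewrite maxEle; case: ifPn => _; lra.
Qed.

Section Lp_energy.
Context (R : realType) (N k : nat) (W : set (Rn R N)) (p : R).
Hypotheses (mW : measurable W) (p_gt0 : 0 < p).
Local Open Scope ereal_scope.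
Implicit Types f g : Rn R N -> 'rV[R]_k.

(** The [p]-th power of the norm, which unlike the norm is directly comparable
    with integrals of pointwise bounds. *)
Definition Lp_energy f : \bar R := \int[leb]_(x in W) (enorm (f x) `^ p)%:E.

Lemma Lp_energy_ge0 f : 0 <= Lp_energy f.
Proof. by apply: integral_ge0 => x _; rewrite lee_fin powR_ge0. Qed.

Lemma Lp_energyE f : Lp_energy f = Lp_norm W p f `^ p.
Proof.
rewrite /Lp_norm poweR_Lnorm ?gt_eqF// /Lp_energy [LHS]integral_mkcond.
apply: eq_integral => x _; rewrite !patchE; case: ifPn => _ /=.
  by rewrite ger0_norm// enorm_ge0.
by rewrite normr0 powR0// gt_eqF.
Qed.

Lemma in_Lp_energy_lty f : in_Lp W p f -> Lp_energy f < +oo.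
Proof. by move=> [_ fp]; rewrite Lp_energyE poweR_lty. Qed.

Lemma measurable_enorm f : (forall i, measurable_fun W (fun x => (f x 0 i)%R)) ->
  measurable_fun W (fun x => enorm (f x)).
Proof.
move=> mf; have msqrt : measurable_fun [set: R] (@Num.sqrt R).
  by apply: continuous_measurable_fun; exact: sqrt_continuous.
rewrite /enorm; apply: (measurableT_comp msqrt).
by rewrite /dotv; apply: measurable_sum => i; exact: measurable_funM.
Qed.

Lemma measurable_powR_enorm f : (forall i, measurable_fun W (fun x => (f x 0 i)%R)) ->
  measurable_fun W (fun x => (enorm (f x) `^ p)%:E).
Proof.
move=> mf; apply/measurable_EFinP.
by apply: (measurableT_comp (measurable_powR p)); exact: measurable_enorm.
Qed.

Lemma Lp_energyD_le f g : (forall i, measurable_fun W (fun x => (f x 0 i)%R)) ->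
  (forall i, measurable_fun W (fun x => (g x 0 i)%R)) ->
  Lp_energy f <= (2 `^ p)%:E * (Lp_energy (fun x => f x - g x)%R + Lp_energy g).
Proof.
move=> mf mg.
have mfg i : measurable_fun W (fun x => ((f x - g x) 0 i)%R).
  by under eq_fun do rewrite !mxE; exact: measurable_funB.
have mef := measurable_powR_enorm mf; have meg := measurable_powR_enorm mg.
have mefg := measurable_powR_enorm mfg.
have en0 (h : Rn R N -> 'rV[R]_k) x : W x -> 0 <= (enorm (h x) `^ p)%:E.
  by rewrite lee_fin powR_ge0.
have msum := emeasurable_funD mefg meg.
have sum0 x : W x -> 0 <= (enorm (f x - g x) `^ p)%:E + (enorm (g x) `^ p)%:E.
  by move=> Wx; rewrite adde_ge0 ?lee_fin ?powR_ge0.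
have p20 : 0 <= (2 `^ p : R)%:E by rewrite lee_fin powR_ge0.
have := ge0_integralD leb mW (en0 (fun x => f x - g x)%R) mefg (en0 g) meg.
rewrite -/(Lp_energy _) -/(Lp_energy _) => <-.
have := ge0_integralZl leb mW msum sum0 p20 => <-.
apply: (ge0_le_integral leb mW (en0 f) mef) => [|x Wx].
  exact: measurable_funeM.
rewrite -EFinD -EFinM lee_fin -{1}(subrK (g x) (f x)).
exact/powR_enormD/ltW.
Qed.

End Lp_energy.

(** * Convex lower semicontinuous functions *)

(** Lower semicontinuity at [0] bounds [phi] below near [0]; convexity along
    the ray through [u] propagates the bound with an affine loss in the norm. *)
Lemma convex_lsc_affine_minorant (R : realType) (X : normedModType R)
    (phi : X -> \bar R) :
  (forall u, phi u != -oo%E) -> convex_efun phi -> lower_semicontinuous phi ->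
  edom phi 0 ->
  exists a b : R, 0 <= b /\ forall u, ((a - b * `|u|)%:E <= phi u)%E.
Proof.
move=> phiNy cphi lphi; rewrite /edom/=.
case phi0E : (phi 0) => [r0||] // _; last by have := phiNy 0; rewrite phi0E.
have [|V /nbhs_ballP[d /= d0 dV] Vphi] := lphi 0 (r0 - 1).
  by rewrite phi0E lte_fin gtrBl.
exists (r0 - 1), (2 / d); split=> [|u]; first by rewrite divr_ge0// ltW.
have [ud|du] := ltP `|u| d.
  apply: (@le_trans _ _ (r0 - 1)%:E).
    by rewrite lee_fin gerBl mulr_ge0// divr_ge0// ltW.
  by apply/ltW/Vphi/dV; rewrite -ball_normE /ball_/= sub0r normrN.
have u0 : 0 < `|u| by apply: lt_le_trans du.
pose t := d / (2 * `|u|).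
have t0 : 0 < t by rewrite divr_gt0// mulr_gt0.
have t1 : t <= 1 by rewrite ler_pdivrMr ?mulr_gt0// mul1r; lra.
have : ((r0 - 1)%:E < phi (t *: u))%E.
  apply/Vphi/dV; rewrite -ball_normE /ball_/= sub0r normrN normrZ gtr0_norm//.
  rewrite /t invfM mulrA mulfVK ?gt_eqF//.
  by rewrite ltr_pdivrMr// ltr_pMr// ltr1n.
have := cphi t u 0 (ltW t0) t1; rewrite scaler0 addr0 phi0E.
case phiuE : (phi u) => [r||]; [|by rewrite leey|by have := phiNy u; rewrite phiuE].
move=> /[swap] /lt_le_trans /[apply]; rewrite -!EFinM -EFinD lte_fin lee_fin => H.
have -> : 2 / d * `|u| = t^-1 by rewrite /t invf_div; field; rewrite gt_eqF.
clearbody t.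
have : t^-1 * (t * r0 - 1) <= t^-1 * (t * r) by rewrite ler_pM2l ?invr_gt0//; lra.
by rewrite mulrBr !(mulrA t^-1) mulVf ?gt_eqF// !mul1r mulr1; lra.
Qed.

Lemma convex_set_segment (R : realType) (X : lmodType R) (K : set X) (t : R) (v w : X) :
  convex_set (K : set (convex_lmodType X)) -> 0 <= t -> t <= 1 ->
  K v -> K w -> K (t *: v + (1 - t) *: w).
Proof.
move=> cK t0 t1 Kv Kw.
by have := cK v w (Itv01 t0 t1) (mem_set Kv) (mem_set Kw); rewrite inE.
Qed.

Lemma dualD (R : realType) (X : normedModType R) (f : dual X) (x y : X) :
  f (x + y) = f x + f y.
Proof. by have := dual_linear f 1 x y; rewrite !scale1r. Qed.

(** * The hemivariational functional *)

Section functional.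
Context (R : realType) (X : normedModType R) (N k : nat) (p C : R)
  (W : set (Rn R N)) (T : X -> Rn R N -> 'rV[R]_k) (j : Rn R N -> 'rV[R]_k -> R).
Hypotheses (p_gt1 : 1 < p) (mW : measurable W) (W_fin : (leb W < +oo)%E)
  (T_linear : linear_to_Lp W p T)
  (mj : forall y, measurable_fun W (j ^~ y))
  (j_lip : forall x, W x -> locally_lipschitz (j x))
  (C_gt0 : 0 < C)
  (j_growth : {ae leb, forall x : Rn R N, W x -> forall y z,
      clarke_grad (j x) y z -> enorm z <= C * (1 + enorm y `^ (p - 1))}).

Let p_gt0 : 0 < p. Proof. exact: lt_trans p_gt1. Qed.

Let mT u i : measurable_fun W (fun x => T u x 0 i).
Proof. by have [+ _] := T_linear => /(_ u)[]. Qed.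

(* Each [T u] is a representative, so even [T 0] is null only almost everywhere. *)
Lemma linear_to_Lp0 : {ae leb, forall x, W x -> T 0 x = 0}.
Proof.
have := T_linear.2 1 0 0; apply: filterS => x + Wx => /(_ Wx).
by rewrite !scale1r addr0 => /(congr1 (fun y => y - T 0 x)) /=; rewrite subrr addrK.
Qed.

Lemma linear_to_LpZ a u : {ae leb, forall x, W x -> T (a *: u) x = a *: T u x}.
Proof.
have := T_linear.2 a u 0; apply: filterS2 linear_to_Lp0 => x T0 + Wx => /(_ Wx).
by rewrite addr0 T0// addr0.
Qed.

Lemma linear_to_LpD a b u v : {ae leb, forall x, W x ->
  T (a *: u + b *: v) x = a *: T u x + b *: T v x}.
Proof.
have := T_linear.2 a u (b *: v); apply: filterS2 (linear_to_LpZ b v).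
by move=> x Tv + Wx => /(_ Wx) ->; rewrite Tv.
Qed.

Definition clarke_integrand (u v : X) (x : Rn R N) : \bar R :=
  clarke_deriv (j x) (T u x) (T v x - T u x).

Definition growth_bound (u v : X) (x : Rn R N) : R :=
  4 * C * (1 + enorm (T u x) `^ p + enorm (T v x) `^ p).

Lemma measurable_clarke_integrand u v : measurable_fun W (clarke_integrand u v).
Proof.
apply: (measurable_clarke_deriv mj j_lip (mT u)) => i.
by under eq_fun do rewrite !mxE; exact: measurable_funB.
Qed.

Lemma clarke_integrand_growth u v : {ae leb, forall x, W x ->
  (`|clarke_integrand u v x| <= (growth_bound u v x)%:E)%E}.
Proof.
apply: filterS j_growth => x jx Wx.
rewrite /clarke_integrand clarke_derivE; last exact: j_lip.
rewrite lee_fin; apply: le_trans (norm_clarke_deriv_le _ (j_lip Wx) (jx Wx _)) _.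
rewrite /growth_bound -!mulrA [leRHS]mulrCA ler_pM2l//.
apply: le_trans (growth_le p_gt1 (enorm_ge0 _) (enorm_ge0 _)).
rewrite ler_wpM2l ?addr_ge0 ?powR_ge0// addrC.
by rewrite (le_trans (ler_enormD _ _))// enormN.
Qed.

Let growth_bound_ge0 u v x : 0 <= growth_bound u v x.
Proof. by rewrite !mulr_ge0 ?addr_ge0 ?powR_ge0// ltW. Qed.

Let measurable_growth_bound u v :
  measurable_fun W (fun x => (growth_bound u v x)%:E).
Proof.
have me w : measurable_fun W (fun x => enorm (T w x) `^ p).
  by apply/measurable_EFinP; apply: measurable_powR_enorm => i; exact: mT.
apply/measurable_EFinP/measurable_funM; first exact: measurable_cst.
exact: measurable_funD (measurable_funD (measurable_cst _) (me u)) (me v).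
Qed.

Lemma integral_growth_bound u v :
  (\int[leb]_(x in W) (growth_bound u v x)%:E =
  (4 * C)%:E * (leb W + Lp_energy W p (T u) + Lp_energy W p (T v)))%E.
Proof.
have me w := measurable_powR_enorm (W := W) p (mT w).
have e0 w x : W x -> (0 <= (enorm (T w x) `^ p)%:E)%E by rewrite lee_fin powR_ge0.
have m1 : measurable_fun W (fun=> 1%E : \bar R) by exact: measurable_cst.
have one0 x : W x -> (0 <= 1 :> \bar R)%E by [].
have mu1 := emeasurable_funD m1 (me u).
have u0 x : W x -> (0 <= 1 + (enorm (T u x) `^ p)%:E)%E.
  by move=> Wx; rewrite adde_ge0 ?e0.
have muv := emeasurable_funD mu1 (me v).
have uv0 x : W x ->
    (0 <= 1 + (enorm (T u x) `^ p)%:E + (enorm (T v x) `^ p)%:E)%E.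
  by move=> Wx; rewrite adde_ge0 ?e0 ?u0.
have C0 : (0 <= (4 * C)%:E)%E by rewrite lee_fin mulr_ge0// ltW.
have I1 := integral_cst leb mW 1%E; rewrite mul1e in I1.
have Iu := ge0_integralD leb mW one0 m1 (e0 u) (me u).
have Iuv := ge0_integralD leb mW u0 mu1 (e0 v) (me v).
exact: etrans (ge0_integralZl leb mW muv uv0 C0) (congr1 _
  (etrans Iuv (congr1 (fun y => y + _)%E (etrans Iu (congr1 (fun y => y + _)%E I1))))).
Qed.

(** The domain has finite measure, which accounts for the constant term of the
    growth condition. *)
Lemma integrable_clarke_integrand u v : leb.-integrable W (clarke_integrand u v).
Proof.
have Ty w := in_Lp_energy_lty p_gt0 (T_linear.1 w).
apply/integrableP; split; first exact: measurable_clarke_integrand.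
apply: (@le_lt_trans _ _ (\int[leb]_(x in W) (growth_bound u v x)%:E)%E).
  apply: (ae_ge0_le_integral (mu := leb) mW).
  - by move=> x _; exact: abse_ge0.
  - exact: measurableT_comp (@abse_measurable R setT) (measurable_clarke_integrand u v).
  - by move=> x _; rewrite lee_fin growth_bound_ge0.
  - exact: measurable_growth_bound.
  - exact: clarke_integrand_growth.
rewrite integral_growth_bound; apply: lte_mul_pinfty.
- by rewrite lee_fin mulr_ge0// ltW.
- by [].
- by apply: lte_add_pinfty (Ty v); exact: lte_add_pinfty (Ty u).
Qed.

Lemma integral_clarke_fin_num u v : (\int[leb]_(x in W) clarke_integrand u v x)%E \is a fin_num.
Proof. exact: (integrable_fin_num (mu := leb) mW (integrable_clarke_integrand u v)). Qed.

Lemma integral_clarke_le u v : (\int[leb]_(x in W) clarke_integrand u v x <=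
  (4 * C)%:E * (leb W + Lp_energy W p (T u) + Lp_energy W p (T v)))%E.
Proof.
apply: le_trans (lee_abs _) _.
apply: le_trans (le_abse_integral leb mW (measurable_clarke_integrand u v)) _.
rewrite -integral_growth_bound; apply: (ae_ge0_le_integral (mu := leb) mW).
- by move=> x _; exact: abse_ge0.
- exact: measurableT_comp (@abse_measurable R setT) (measurable_clarke_integrand u v).
- by move=> x _; rewrite lee_fin growth_bound_ge0.
- exact: measurable_growth_bound.
- exact: clarke_integrand_growth.
Qed.

Lemma integral_clarke_diag u : (\int[leb]_(x in W) clarke_integrand u u x)%E = 0%E.
Proof.
apply: (integral0_eq leb) => x Wx; rewrite /clarke_integrand subrr clarke_derivE ?sublinear0//.
  exact/sublinear_clarke_deriv/j_lip.
exact: j_lip.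
Qed.

Lemma integral_clarke0 u :
  (\int[leb]_(x in W) clarke_deriv (j x) (T u x) (- T u x) =
   \int[leb]_(x in W) clarke_integrand u 0%R x)%E.
Proof.
apply: (ae_eq_integral _ _ mW).
- apply: (measurable_clarke_deriv mj j_lip (mT u)) => i.
  by under eq_fun do rewrite !mxE; exact: measurableT_comp.
- exact: measurable_clarke_integrand.
by apply: filterS linear_to_Lp0 => x T0 Wx; rewrite /clarke_integrand (T0 Wx) sub0r.
Qed.

(** The integral inherits convexity in [v] from the sublinearity of the
    directional derivative; integrability of both terms is what allows the
    integral of the sum to be split. *)
Lemma integral_clarke_convex u v w (t : R) : 0 <= t -> t <= 1 ->
  (\int[leb]_(x in W) clarke_integrand u (t *: v + (1 - t) *: w)%R x <=
   t%:E * \int[leb]_(x in W) clarke_integrand u v x +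
   (1 - t)%:E * \int[leb]_(x in W) clarke_integrand u w x)%E.
Proof.
move=> t0 t1; pose h x := t *: (T v x - T u x) + (1 - t) *: (T w x - T u x).
have mh : measurable_fun W (fun x => clarke_deriv (j x) (T u x) (h x)).
  apply: (measurable_clarke_deriv mj j_lip (mT u)) => i; rewrite /h.
  under eq_fun do rewrite !mxE.
  have mB w' : measurable_fun W (fun x => T w' x 0 i - T u x 0 i).
    exact: measurable_funB.
  by apply: measurable_funD; apply: measurable_funM; rewrite ?mB//;
    exact: measurable_cst.
have hE : {ae leb, forall x, W x -> clarke_integrand u (t *: v + (1 - t) *: w) x =
    clarke_deriv (j x) (T u x) (h x)}.
  apply: filterS (linear_to_LpD t (1 - t) v w) => x Tx Wx.
  rewrite /clarke_integrand (Tx Wx); congr clarke_deriv; rewrite /h !scalerBr addrACA.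
  by rewrite -opprD -scalerDl [t + _]addrC subrK scale1r.
rewrite [leLHS](ae_eq_integral _ _ mW (measurable_clarke_integrand _ _) mh hE).
have iv := integrableZl mW t (integrable_clarke_integrand u v).
have iw := integrableZl mW (1 - t) (integrable_clarke_integrand u w).
rewrite -(integralZl mW (integrable_clarke_integrand u v)) -(integralZl mW (integrable_clarke_integrand u w)).
rewrite -(integralD mW iv iw).
apply: (le_integral mW _ (integrableD mW iv iw)).
  have /integrableP[mjf] := integrable_clarke_integrand u (t *: v + (1 - t) *: w).
  have hEabs : ae_eq leb W (abse \o clarke_integrand u (t *: v + (1 - t) *: w))
      (abse \o (fun x => clarke_deriv (j x) (T u x) (h x))).
    by apply: filterS hE => x + Wx => /(_ Wx) /= ->.
  have mabs := @abse_measurable R setT.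
  have := ae_eq_integral _ _ mW (measurableT_comp mabs mjf)
    (measurableT_comp mabs mh) hEabs.
  move=> intE int_lty; apply/integrableP.
  exact: conj mh (eq_ind _ (fun y => y < +oo)%E int_lty _ intE).
move=> x; rewrite inE => /j_lip Lx; rewrite /clarke_integrand !clarke_derivE//.
have slP := sublinear_clarke_deriv (T u x) Lx.
rewrite -!EFinM -EFinD lee_fin -!(sublinearZ _ slP) ?subr_ge0//.
exact: slP.1.
Qed.

End functional.

(** * From solutions on balls to global solutions *)

(** Near [w] the segment from [w] to [v] stays in the ball, where [F] is
    nonnegative; there [F] lies below its chord, whose end at [w] is nonpositive,
    so the end at [v] is nonnegative. *)
Lemma convex_chord_ge0 (R : realType) (X : normedModType R) (K : set X)
    (F : X -> \bar R) (r : R) (w : X) :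
  convex_set (K : set (convex_lmodType X)) ->
  (forall t v, 0 < t -> t < 1 -> (F (t *: v + (1 - t) *: w)%R <=
     t%:E * F v + (1 - t)%:E * F w)%E) ->
  (forall v, K v -> `|v| <= r -> (0 <= F v)%E) ->
  K w -> `|w| < r -> (F w <= 0)%E -> forall v, K v -> (0 <= F v)%E.
Proof.
move=> cK cF Fr Kw wr Fw v Kv.
have vw : 0 < 1 + `|v - w| by rewrite ltr_pwDl.
have rw : 0 < r - `|w| by rewrite subr_gt0.
(* The cap 2^-1 keeps t below 1; the other bound keeps the point in the ball. *)
pose t := Num.min 2^-1 ((r - `|w|) / (1 + `|v - w|)).
have t0 : 0 < t by rewrite lt_min invr_gt0 divr_gt0// ltr0n.
have t1 : t < 1.
  by rewrite (@le_lt_trans _ _ 2^-1)// ?ge_min ?lexx// invf_lt1// ltr1n.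
have tvw : t * (1 + `|v - w|) <= r - `|w|.
  by rewrite -ler_pdivlMr// ge_min lexx orbT.
have Kt := convex_set_segment cK (ltW t0) (ltW t1) Kv Kw.
have tr : `|t *: v + (1 - t) *: w| <= r.
  rewrite scalerBl scale1r addrCA -scalerBr.
  rewrite (le_trans (ler_normD _ _))// normrZ gtr0_norm//; nra.
have := le_trans (Fr _ Kt tr) (cF t v t0 t1).
have w0 : ((1 - t)%:E * F w <= 0)%E by rewrite mule_ge0_le0// lee_fin subr_ge0 ltW.
move=> /le_trans => /(_ _ (leeD2l _ w0)); rewrite adde0.
by rewrite pmule_rge0// lte_fin.
Qed.

(** Convexity of the sum of an affine term, [phi] and the integral, in extended
    real numbers: [qv] and [qw] may be [+oo]. *)
Lemma chord_leD (R : realType) (t a av aw : R) (q qu qv qw J Jv Jw : \bar R) :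
  0 < t -> t < 1 -> a = t * av + (1 - t) * aw ->
  qu != -oo%E -> (qu < +oo)%E -> qv != -oo%E -> qw != -oo%E ->
  J \is a fin_num -> Jv \is a fin_num -> Jw \is a fin_num ->
  (q <= t%:E * qv + (1 - t)%:E * qw)%E -> (J <= t%:E * Jv + (1 - t)%:E * Jw)%E ->
  (a%:E + q - qu + J <=
   t%:E * (av%:E + qv - qu + Jv) + (1 - t)%:E * (aw%:E + qw - qu + Jw))%E.
Proof.
move=> t0 t1 ->; have t1' : 0 < 1 - t by rewrite subr_gt0.
case: qu => // qu _ _; case: J => // J; case: Jv => // Jv; case: Jw => // Jw.
case: qv => [qv||]// _; case: qw => [qw||]//.
- case: q => [q||] _ _ _; rewrite -!(EFinM, EFinD, EFinN) ?lee_fin; first by lra.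
    by rewrite leNgt ltry.
  by move=> _ _; rewrite /= leNye.
- by move=> *; rewrite /= gt0_muley ?lte_fin// addey// leey.
- by move=> *; rewrite /= gt0_muley ?lte_fin// addye// leey.
- by move=> *; rewrite /= !gt0_muley ?lte_fin// addye// leey.
Qed.

Section hemivariational.
Context (R : realType) (X : normedModType R) (N k : nat) (p C : R)
  (W : set (Rn R N)) (T : X -> Rn R N -> 'rV[R]_k) (j : Rn R N -> 'rV[R]_k -> R)
  (phi : X -> \bar R).
Hypotheses (p_gt1 : 1 < p) (mW : measurable W) (W_fin : (leb W < +oo)%E)
  (T_linear : linear_to_Lp W p T)
  (mj : forall y, measurable_fun W (j ^~ y))
  (j_lip : forall x, W x -> locally_lipschitz (j x))
  (C_gt0 : 0 < C)
  (j_growth : {ae leb, forall x : Rn R N, W x -> forall y z,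
      clarke_grad (j x) y z -> enorm z <= C * (1 + enorm y `^ (p - 1))})
  (phi_proper : forall u, phi u != -oo%E) (phi_convex : convex_efun phi).

Let fin_J := integral_clarke_fin_num p_gt1 mW W_fin T_linear mj j_lip C_gt0 j_growth.
Let convex_J := integral_clarke_convex p_gt1 mW W_fin T_linear mj j_lip C_gt0 j_growth.

Lemma hemivarE u us v : hemivar W phi T j u us v =
  ((us (v - u)%R)%:E + phi v - phi u + \int[leb]_(x in W) clarke_integrand T j u v x)%E.
Proof. by []. Qed.

(** Outside the domain of [phi] the functional is [-oo]. *)
Lemma hemivar_ge0_edom u us v : (0 <= hemivar W phi T j u us v)%E -> edom phi u.
Proof.
rewrite hemivarE /edom/=; case: (phi u) => [r _|| //]; first exact: ltry.
by rewrite /= addeNy addNye.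
Qed.

Lemma hemivar_convex u us v w (t : R) : edom phi u -> 0 < t -> t < 1 ->
  (hemivar W phi T j u us (t *: v + (1 - t) *: w)%R <=
   t%:E * hemivar W phi T j u us v + (1 - t)%:E * hemivar W phi T j u us w)%E.
Proof.
move=> phiu t0 t1; have t1' : 0 < 1 - t by rewrite subr_gt0.
have usE : us (t *: v + (1 - t) *: w - u) = t * us (v - u) + (1 - t) * us (w - u).
  rewrite -[X in _ = X + _]dualZ -[X in _ = _ + X]dualZ -dualD; congr (us _).
  rewrite !scalerBr addrACA; congr (_ + _).
  by rewrite -opprD -scalerDl [t + _]addrC subrK scale1r.
exact: (chord_leD t0 t1 usE (phi_proper u) phiu (phi_proper v) (phi_proper w)
  (fin_J u _) (fin_J u v) (fin_J u w) (phi_convex v w (ltW t0) (ltW t1))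
  (convex_J u v w (ltW t0) (ltW t1))).
Qed.

Lemma hemivar_ball_global (K : set X) (r : R) u us w :
  convex_set (K : set (convex_lmodType X)) ->
  (forall v, K v -> `|v| <= r -> (0 <= hemivar W phi T j u us v)%E) ->
  K w -> `|w| < r -> (hemivar W phi T j u us w <= 0)%E ->
  forall v, K v -> (0 <= hemivar W phi T j u us v)%E.
Proof.
move=> cK Hr Kw wr; apply: (convex_chord_ge0 cK _ Hr Kw wr) => t v.
exact/hemivar_convex/(hemivar_ge0_edom (Hr _ Kw (ltW wr))).
Qed.

Lemma hemivar_diag u us : edom phi u -> hemivar W phi T j u us u = 0%E.
Proof.
move=> phiu; rewrite hemivarE subrr.
have -> : us 0 = 0 by have := dualZ us 0 0; rewrite !scale0r.
rewrite [X in (_ + X)%E](integral_clarke_diag T j_lip u) adde0 add0e subee//.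
by rewrite fin_numE phi_proper lt_eqF.
Qed.

(** Testing the inequality with [u0] bounds [us (u - u0)] by quantities that
    grow at most like the norm of [u] and the energy of [T u]. *)
Lemma hemivar_test_bound u us u0 (a b E : R) :
  (0 <= hemivar W phi T j u us u0)%E -> edom phi u0 ->
  ((a - b * `|u|)%:E <= phi u)%E -> (Lp_energy W p (T u) <= E%:E)%E ->
  us (u - u0) <= fine (phi u0) - a + b * `|u| +
    4 * C * (fine (leb W) + E + fine (Lp_energy W p (T u0))).
Proof.
move=> H0 phiu0 phiu TuE; have phiu_fin := hemivar_ge0_edom H0; move: H0.
rewrite hemivarE.
have Jle := integral_clarke_le p_gt1 mW T_linear mj j_lip C_gt0 j_growth u u0.
have p_gt0 : 0 < p by apply: lt_trans p_gt1.
have usN : us (u0 - u) = - us (u - u0).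
  by have := dualZ us (-1) (u - u0); rewrite !scaleN1r opprB.
have Wf : leb W \is a fin_num by rewrite ge0_fin_numE.
have Tu0f : Lp_energy W p (T u0) \is a fin_num.
  have Tu0y := in_Lp_energy_lty p_gt0 (T_linear.1 u0).
  by rewrite ge0_fin_numE; [exact: Tu0y|exact: Lp_energy_ge0].
have := le_trans Jle (lee_wpmul2l _ (leeD2r _ (leeD2l _ TuE))).
rewrite lee_fin mulr_ge0 ?(ltW C_gt0)// => /(_ isT).
have := fin_J u u0; case: (integral _ _ _) => // J _.
rewrite -(fineK Wf) -(fineK Tu0f) -!EFinD -EFinM lee_fin.
move: phiu phiu_fin phiu0 (phi_proper u0); rewrite /edom/=.
case: (phi u) => [ru||]//; case: (phi u0) => [r0||]//; rewrite !lee_fin => phiu _ _ _.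
by rewrite /= usN; lra.
Qed.

End hemivariational.

Section coercive.
Context (R : realType) (X : normedModType R) (N k : nat) (p : R)
  (W : set (Rn R N)) (T : X -> Rn R N -> 'rV[R]_k).
Hypotheses (p_gt1 : 1 < p) (mW : measurable W)
  (T_linear : linear_to_Lp W p T) (T_compact : compact_to_Lp W p T).

Let p_gt0 : 0 < p. Proof. exact: lt_trans p_gt1. Qed.

Lemma Lp_energy_linearZ (a : R) u : 0 <= a ->
  Lp_energy W p (T (a *: u)) = ((a `^ p)%:E * Lp_energy W p (T u))%E.
Proof.
move=> a0; have mT v i : measurable_fun W (fun x => T v x 0 i).
  by have [+ _] := T_linear => /(_ v)[].
have e0 v x : W x -> (0 <= (enorm (T v x) `^ p)%:E)%E by rewrite lee_fin powR_ge0.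
have ap : (0 <= (a `^ p)%:E)%E by rewrite lee_fin powR_ge0.
have mu := measurable_powR_enorm (W := W) p (mT u).
have mau := measurable_powR_enorm (W := W) p (mT (a *: u)).
have TE : ae_eq leb W (fun x => (enorm (T (a *: u) x) `^ p)%:E)
    (fun x => ((a `^ p)%:E * (enorm (T u x) `^ p)%:E)%E).
  apply: filterS (linear_to_LpZ T_linear a u) => x Tx Wx.
  by rewrite (Tx Wx) enormZ ger0_norm// powRM// enorm_ge0.
exact: etrans (ae_eq_integral _ _ mW mau (measurable_funeM _ mu) TE)
  (ge0_integralZl leb mW mu (e0 u) ap).
Qed.

(** Along a subsequence with convergent images, these are eventually at distance
    less than [1] from the limit. *)
Lemma compact_to_Lp_energy_bounded (z : nat -> X) :
  (exists M, forall n, `|z n| <= M) ->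
  exists s : nat -> nat, {homo s : m n / (m < n)%N} /\
  exists B : R, 0 <= B /\
    \forall n \near \oo, (Lp_energy W p (T (z (s n))) <= B%:E)%E.
Proof.
move=> /T_compact[s [s_incr [f [f_Lp cvf]]]]; exists s; split=> //.
have ff : Lp_energy W p f \is a fin_num.
  have fy := in_Lp_energy_lty p_gt0 f_Lp.
  by rewrite ge0_fin_numE; [exact: fy|exact: Lp_energy_ge0].
exists (2 `^ p * (1 + fine (Lp_energy W p f))); split.
  by rewrite mulr_ge0 ?powR_ge0// addr_ge0// fine_ge0// Lp_energy_ge0.
have [fin_norm cv0] := (fine_cvgP _ _).1 cvf.
have norm_lt1 := cvgr_lt _ cv0 1 ltr01.
apply: filterS2 fin_norm (norm_lt1 _) => n nfin nlt1.
have mTz i : measurable_fun W (fun x => T (z (s n)) x 0 i).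
  by have [+ _] := T_linear => /(_ (z (s n)))[].
apply: le_trans (Lp_energyD_le mW p_gt0 mTz f_Lp.1) _.
rewrite EFinM EFinD fineK//; apply: lee_wpmul2l; first by rewrite lee_fin powR_ge0.
apply: leeD2r; rewrite Lp_energyE//.
rewrite -(fineK nfin) poweR_EFin lee_fin; move: nlt1 => /= nlt1.
have n0 : 0 <= fine (Lp_norm W p (fun x => T (z (s n)) x - f x)).
  by rewrite fine_ge0// Lnorm_ge0.
apply: (@le_trans _ _ (1 `^ p)); last by rewrite powR1.
by apply: ge0_ler_powR; rewrite ?nnegrE// ltW.
Qed.

End coercive.

(** If no solution on a ball were interior, the [n]-th one would have norm [n];
    testing with [u0] and using compactness along a subsequence, the pairing
    would grow at most like the [p]-th power of the norm, against coercivity. *)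
Lemma coercive_interior (R : realType) (X : normedModType R) (N k : nat)
    (p q C : R) (W : set (Rn R N)) (T : X -> Rn R N -> 'rV[R]_k)
    (j : Rn R N -> 'rV[R]_k -> R) (phi : X -> \bar R) (K : set X)
    (A : X -> set (dual X)) (u : nat -> X) (us : nat -> dual X) (u0 : X) :
  1 < p -> measurable W -> (leb W < +oo)%E ->
  linear_to_Lp W p T -> compact_to_Lp W p T ->
  (forall y, measurable_fun W (j ^~ y)) ->
  (forall x, W x -> locally_lipschitz (j x)) -> 0 < C ->
  {ae leb, forall x : Rn R N, W x -> forall y z,
      clarke_grad (j x) y z -> enorm z <= C * (1 + enorm y `^ (p - 1))} ->
  (forall v, phi v != -oo%E) -> convex_efun phi -> lower_semicontinuous phi ->
  edom phi 0 ->
  (forall n, (1 <= n)%N -> K (u n) /\ `|u n| <= n%:R) ->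
  (forall n, (1 <= n)%N -> A (u n) (us n)) ->
  (forall n, (1 <= n)%N -> forall v, K v -> `|v| <= n%:R ->
    (0 <= hemivar W phi T j (u n) (us n) v)%E) ->
  K u0 -> edom phi u0 -> p <= q ->
  (forall w : nat -> X, (forall n, K (w n)) -> `|w n| @[n --> \oo] --> +oo ->
    forall ws : nat -> dual X, (forall n, A (w n) (ws n)) ->
    ws n (w n - u0) / `|w n| `^ q @[n --> \oo] --> +oo) ->
  exists2 n0 : nat, (1 <= n0)%N & `|u n0| < n0%:R.
Proof.
move=> p1 mW W_fin lT cT mj jL C0 jg phiNy cphi lphi phi0 uK usA uS Ku0 phiu0 pq co.
apply: contrapT => no_int.
have u_norm n : `|u n.+1| = n.+1%:R.
  apply/eqP; rewrite eq_le (uK n.+1 _).2//= leNgt; apply/negP => un.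
  by apply: no_int; exists n.+1.
have n0 n : 0 < n.+1%:R :> R by [].
(* Compactness applies to bounded sequences, so the solutions are normalized. *)
pose z n := n.+1%:R^-1 *: u n.+1.
have [|s [s_incr [B [B0 TzB]]]] :=
    @compact_to_Lp_energy_bounded R X N k p W T p1 mW lT cT z.
  exists 1 => n.
  by rewrite normrZ normfV u_norm (gtr0_norm (n0 n)) mulVf// gt_eqF.
have s_ge n : (n <= s n)%N.
  by elim: n => // n IH; rewrite (leq_ltn_trans IH)// s_incr.
have [a [b [b0 phiab]]] := convex_lsc_affine_minorant phiNy cphi lphi phi0.
pose w n := u (s n).+1.
have w_cvg : `|w n| @[n --> \oo] --> +oo.
  apply: (ger_cvgy (f := fun n => n%:R : R) _ cvgr_idn); apply: nearW => n.
  by rewrite /w u_norm ler_nat (leq_trans (s_ge n)).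
have /cvgryPgt := co w (fun n => (uK (s n).+1 isT).1) w_cvg
  (fun n => us (s n).+1) (fun n => usA (s n).+1 isT).
pose c0 := fine (phi u0) - a +
  4 * C * (fine (leb W) + fine (Lp_energy W p (T u0))).
move=> /(_ (`|c0| + b + 4 * C * B)) big.
have u0_le : \forall n \near \oo, `|u0| <= n%:R by exact: nbhs_infty_ger.
near \oo => n.
have : `|c0| + b + 4 * C * B < us (s n).+1 (w n - u0) / `|w n| `^ q.
  by near: n; exact: big.
apply/negP; rewrite -leNgt.
pose m : R := (s n).+1%:R.
have m1 : 1 <= m by rewrite ler1n.
have m0 : 0 <= m by apply: le_trans m1.
have mq0 : 0 < m `^ q by rewrite powR_gt0// (lt_le_trans ltr01).
have mpq : m `^ p <= m `^ q by exact: ler_powR.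
have mq : m <= m `^ q by rewrite -[leLHS]powRr1// ler_powR// (le_trans (ltW p1)).
have mq1 : 1 <= m `^ q by apply: le_trans mq.
rewrite /w u_norm -/m ler_pdivrMr//.
have u0_m : `|u0| <= m.
  have u0n : `|u0| <= n%:R by near: n.
  by rewrite (le_trans u0n)// ler_nat (leq_trans (s_ge n)).
have TwE : (Lp_energy W p (T (w n)) <= (m `^ p * B)%:E)%E.
  have -> : w n = m *: z (s n).
    by rewrite /z scalerA divff ?scale1r// gt_eqF.
  rewrite (Lp_energy_linearZ mW lT _ m0) EFinM; apply: lee_wpmul2l.
    by rewrite lee_fin powR_ge0.
  by near: n.
have := hemivar_test_bound p1 mW W_fin lT mj jL C0 jg phiNy
  (uS (s n).+1 isT u0 Ku0 u0_m) phiu0 (phiab _) TwE.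
rewrite u_norm -/m => /le_trans; apply.
(* Each of the terms 1, m and m `^ p is at most m `^ q, as m >= 1 and q >= p. *)
have CB : m `^ p * (4 * C * B) <= m `^ q * (4 * C * B).
  by rewrite ler_wpM2r// !mulr_ge0// ltW.
have bq : b * m <= b * m `^ q by rewrite ler_wpM2l.
have cq : c0 <= `|c0| * m `^ q.
  by rewrite (le_trans (ler_norm _))// ler_peMr.
by move: cq; rewrite {1}/c0; lra.
Unshelve. all: by end_near. Qed.

(** * The existence theorem *)

Theorem theorem3 (R : realType) (X : completeNormedModType R)
  (X_reflexive : reflexive_space X)
  (N k : nat) (k_ge1 : (1 <= k)%N) (p : R) (p_gt1 : 1 < p)
  (Omega : set 'rV[R]_N) (Omega_open : open Omega)
  (Omega_bounded : bounded_set Omega)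
  (K : set X) (K_nonempty : K !=set0) (K_closed : closed K)
  (K_convex : convex_set (K : set (convex_lmodType X)))
  (A : X -> set (dual X)) (A_nonempty : forall u, K u -> A u !=set0)
  (A_monotone : monotone_on K A)
  (A_lhc : lower_hemicontinuous_on K A)
  (phi : X -> \bar R) (phi_proper : forall u, phi u != -oo%E)
  (phi_convex : convex_efun phi) (phi_lsc : lower_semicontinuous phi)
  (K0 : K 0) (phi0 : edom phi 0)
  (T : X -> Rn R N -> 'rV[R]_k)
  (T_linear : linear_to_Lp Omega p T) (T_compact : compact_to_Lp Omega p T)
  (j : Rn R N -> 'rV[R]_k -> R)
  (j_caratheodory : caratheodory_function Omega j)
  (j_lipschitz : forall x, Omega x -> locally_lipschitz (j x))
  (j_growth : exists2 C : R, 0 < C &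
    {ae leb, forall x : Rn R N, Omega x -> forall y z,
      clarke_grad (j x) y z -> enorm z <= C * (1 + enorm y `^ (p - 1))})
  (u : nat -> X) (us : nat -> dual X)
  (u_K : forall n, (1 <= n)%N -> K (u n) /\ `|u n| <= n%:R)
  (us_A : forall n, (1 <= n)%N -> A (u n) (us n))
  (u_sol : forall n, (1 <= n)%N -> forall v, K v -> `|v| <= n%:R ->
    (0 <= hemivar Omega phi T j (u n) (us n) v)%E)
  (H :
    [\/ exists2 n0 : nat, (1 <= n0)%N & `|u n0| < n0%:R,
        exists2 n0 : nat, (1 <= n0)%N &
          ((us n0 (- u n0)%R)%:E + phi 0%R - phi (u n0)
           + \int[leb]_(x in (Omega : set (Rn R N)))
               clarke_deriv (j x) (T (u n0) x) (- T (u n0) x)%R <= 0)%E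
      | exists u0 : X, exists q : R,
          [/\ K u0, edom phi u0, p <= q &
            forall w : nat -> X, (forall n, K (w n)) ->
              `|w n| @[n --> \oo] --> +oo ->
            forall ws : nat -> dual X, (forall n, A (w n) (ws n)) ->
              ws n (w n - u0) / `|w n| `^ q @[n --> \oo] --> +oo]]) :
  exists u' : X, exists us' : dual X,
    [/\ K u', A u' us' &
      forall v, K v -> (0 <= hemivar Omega phi T j u' us' v)%E].
Proof.
have mO := open_measurable_Rn Omega_open.
have Oy := leb_bounded_lty Omega_bounded.
have [C C0 jC] := j_growth; have mj := j_caratheodory.1.
(* Everything reduces to a strictly interior test point w with a nonpositive
   value: w = u n0 in the first and third cases, w = 0 in the second. *)
suff [n0 [w [n01 Kw wn0 Fw]]] : exists n0 w, [/\ (1 <= n0)%N, K w,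
    `|w| < n0%:R & (hemivar Omega phi T j (u n0) (us n0) w <= 0)%E].
  exists (u n0), (us n0); split; [exact: (u_K n0 n01).1|exact: us_A|].
  exact: (hemivar_ball_global p_gt1 mO Oy T_linear mj j_lipschitz C0 jC
    phi_proper phi_convex K_convex (u_sol n0 n01) Kw wn0 Fw).
have u_dom n : (1 <= n)%N -> edom phi (u n).
  move=> n1; apply: (@hemivar_ge0_edom _ _ _ _ Omega T j phi (u n) (us n) 0).
  by apply: u_sol => //; rewrite normr0.
have interior : (exists2 n0 : nat, (1 <= n0)%N & `|u n0| < n0%:R) ->
    exists n0 w, [/\ (1 <= n0)%N, K w, `|w| < n0%:R &
      (hemivar Omega phi T j (u n0) (us n0) w <= 0)%E].
  move=> [n0 n01 un0]; exists n0, (u n0); split=> //.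
    exact: (u_K n0 n01).1.
  by rewrite (hemivar_diag _ j_lipschitz phi_proper _ (u_dom n0 n01)).
case: H => [/interior//|[n0 n01 F0]|[u0 [q [Ku0 phiu0 pq co]]]].
  exists n0, 0; split; [exact: n01|exact: K0|by rewrite normr0 ltr0n|].
  have J0 := integral_clarke0 mO T_linear mj j_lipschitz (u n0).
  by rewrite hemivarE sub0r -[X in (_ + X <= 0)%E]J0.
apply: interior.
exact: (coercive_interior p_gt1 mO Oy T_linear T_compact mj j_lipschitz C0 jC
  phi_proper phi_convex phi_lsc phi0 u_K us_A u_sol Ku0 phiu0 pq co).
Qed.
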